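(* Let $k$ be a field with separable closure $\overline k$. Let $Y$ be an integral $k$-variety such that $H^0(Y_{\overline k},\mathcal{O}_{Y_{\overline k}})^\times=\overline k^\times$. Let $R$ be a Cox ring of $Y$ of type $M\subseteq\operatorname{Pic}(Y)$ for a finitely generated subgroup $M$ of $\operatorname{Pic}(Y)$. Assume that there exist finitely many homogeneous elements $g_1,\dots,g_m\in R$ such that $Y\smallsetminus\operatorname{Supp}(D_{g_1}),\dots,Y\smallsetminus\operatorname{Supp}(D_{g_m})$ form an open covering of $Y$ that refines an affine open covering of $Y$. Let $X\subseteq Y$ be a complete intersection of hypersurfaces $D_{f_1},\dots,D_{f_s}$ with $f_1,\dots,f_s\in R$ homogeneous. Then $X$ is a strict complete intersection with respect to $R$ of the hypersurfaces $D_{f_1},\dots,D_{f_s}$ defined by $f_1,\dots,f_s$ if and only if the ideal $\sum_{i=1}^sf_iR$ is saturated with respect to the ideal $\sum_{i=1}^mg_iR$.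
   Context: Conventions. A $k$-variety is a separated scheme of finite type over $k$; a closed subvariety is a closed subscheme (not assumed reduced). A hypersurface $H$ of $Y$ is (the closed subscheme given by) an effective Cartier divisor, with ideal sheaf $\mathscr{I}_H=\mathcal{O}_Y(-H)$. Cox ring of type $M\subseteq\operatorname{Pic}(Y)$: an $M$-graded $k$-algebra $R=\bigoplus_{m\in M}R_m$ of the form $R_m=H^0(Y,\mathcal{L}_m)$, where $\bigoplus_{m\in M}\mathcal{L}_m$ is an $M$-graded commutative $\mathcal{O}_Y$-algebra with $\mathcal{L}_0=\mathcal{O}_Y$, each $\mathcal{L}_m$ is an invertible sheaf of class $m$, and all multiplication maps $\mathcal{L}_m\otimes\mathcal{L}_{m'}\to\mathcal{L}_{m+m'}$ are isomorphisms. Every nonzero homogeneous $f\in R_m$ defines an effective Cartier divisor $D_f$ on $Y$ of class $m$ (the zero divisor of the section $f$ of $\mathcal{L}_m$). A covering of $Y$ by open subsets $U_i$ refines an affine open covering if each $U_i$ is contained in a member of that affine open covering. Complete intersection: a closed subvariety $X\subseteq Y$ is a complete intersection of hypersurfaces $H_1,\dots,H_s$ if $\dim X+s=\dim Y$ and $\mathscr{I}_X=\mathscr{I}_{H_1}+\dots+\mathscr{I}_{H_s}$. For an ideal sheaf $\mathscr{I}\subseteq\mathcal{O}_Y$, $\psi(\mathscr{I})$ is the ideal of $R$ generated by all homogeneous $f\in R$ with $\mathcal{O}_Y(-D_f)\subseteq\mathscr{I}$. Strict complete intersection: a closed subvariety $X\subseteq Y$ of codimension $s$ is a strict complete intersection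 with respect to $R$ of hypersurfaces $H_1,\dots,H_s$ defined by homogeneous $f_1,\dots,f_s\in R$ if $X$ is the complete intersection of $H_1,\dots,H_s$ and the ideal $\psi(\mathscr{I}_X)$ is generated by $f_1,\dots,f_s$. Saturation: for ideals $I,G$ of a ring $R$, $(I:G^\infty)=\{f\in R: fG^N\subseteq I\text{ for some }N\ge 0\}$; $I$ is saturated with respect to $G$ if $(I:G^\infty)=I$. *)

(* Defs.v *)
From HB Require Import structures.
From mathcomp Require Import all_boot all_order all_algebra all_field.
From mathcomp Require Import mathcomp_extra boolp classical_sets topology.

Set Implicit Arguments.
Unset Strict Implicit.
Unset Printing Implicit Defensive.

Import GRing.Theory.
Local Open Scope classical_set_scope.
Local Open Scope ring_scope.

Section CommutativeAlgebra.
Variable A : comPzRingType.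

Definition ideal_gen (S : set A) : set A :=
  [set r | exists n (a x : 'I_n -> A),
      (forall i, S (x i)) /\ r = \sum_(i < n) a i * x i].

Fixpoint ideal_pow (G : set A) (N : nat) : set A :=
  if N is N'.+1
  then ideal_gen [set r | exists x y, [/\ ideal_pow G N' x, G y & r = x * y]]
  else setT.

Definition saturation (I G : set A) : set A :=
  [set f | exists N : nat, forall g, ideal_pow G N g -> I (f * g)].

Definition saturated (I G : set A) : Prop := saturation I G = I.

(* [h] exhibits its codomain as the localization of [A] at the powers of [a]. *)
Definition is_localization (B : comPzRingType) (h : {rmorphism A -> B})
    (a : A) : Prop :=
  [/\ exists c : B, h a * c = 1,
      forall b : B, exists (n : nat) (x : A), b * h a ^+ n = h x &
      forall x : A, h x = 0 -> exists n : nat, a ^+ n * x = 0].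

Definition finite_type_algebra (B : comPzRingType) (h : {rmorphism A -> B})
    : Prop :=
  exists gens : seq B, forall S : set B,
    (forall a, S (h a)) -> (forall x, x \in gens -> S x) ->
    (forall x y, S x -> S y -> S (x + y)) ->
    (forall x y, S x -> S y -> S (x * y)) ->
    forall x, S x.

End CommutativeAlgebra.

Definition integral_domain (A : comPzRingType) : Prop :=
  (1 : A) <> 0 /\ forall a b : A, a * b = 0 -> a = 0 \/ b = 0.

Definition is_separable_closure (k kbar : fieldType)
    (iota : {rmorphism k -> kbar}) : Prop :=
  (forall x : kbar, exists2 p : {poly k},
      separable_poly p & root (map_poly iota p) x) /\
  (forall p : {poly kbar}, separable_poly p -> (1 < size p)%N ->
      exists x, root p x).

Definition finitely_generated (M : zmodType) : Prop :=
  exists n (gens : n.-tuple M), forall v : M, inIntSpan gens v.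

Record Spec (A : comPzRingType) := MkSpec {
  spec_ideal :> set A;
  spec0 : spec_ideal 0;
  specD : forall x y, spec_ideal x -> spec_ideal y -> spec_ideal (x + y);
  specM : forall a x, spec_ideal x -> spec_ideal (a * x);
  spec1 : ~ spec_ideal 1;
  spec_prime : forall x y, spec_ideal (x * y) -> spec_ideal x \/ spec_ideal y
}.

HB.instance Definition _ (A : comPzRingType) := gen_eqMixin (Spec A).
HB.instance Definition _ (A : comPzRingType) := gen_choiceMixin (Spec A).

Section Zariski.
Variable A : comPzRingType.

Definition basic_open (a : A) : set (Spec A) := [set p : Spec A | ~ spec_ideal p a].

Definition zariski : set_system (Spec A) :=
  [set W | exists E : set A, W = \bigcup_(a in E) basic_open a].

Lemma zariskiT : zariski setT.
Proof.
exists setT; apply/seteqP; split => // p _.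
by exists 1 => //; exact: spec1.
Qed.

Lemma zariskiI : setI_closed zariski.
Proof.
move=> _ _ [E ->] [F ->].
exists [set c | exists a b, [/\ E a, F b & c = a * b]].
apply/seteqP; split=> p /=.
  move=> [[a Ea pa] [b Fb pb]]; exists (a * b); first by exists a, b.
  by move=> /spec_prime [].
move=> [_ [a [b [Ea Fb ->]]] pab]; split.
  by exists a => // pa; apply: pab; rewrite mulrC; exact: specM.
by exists b => // pb; apply: pab; exact: specM.
Qed.

Lemma zariski_bigU (I : Type) (f : I -> set (Spec A)) :
  (forall i, zariski (f i)) -> zariski (\bigcup_i f i).
Proof.
move=> zf; exists [set a | exists i, basic_open a `<=` f i].
apply/seteqP; split=> p /=.
  move=> [i _]; have [E fE] := zf i; rewrite fE => -[a Ea pa].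
  by exists a => //; exists i; rewrite fE => q qa; exists a.
by move=> [a [i fi] pa]; exists i => //; exact: fi.
Qed.

HB.instance Definition _ :=
  isOpenTopological.Build (Spec A) zariskiT zariskiI zariski_bigU.

End Zariski.

Record opens (T : topologicalType) := Opens {
  oset :> set T;
  opens_open : open oset
}.

Definition opensT (T : topologicalType) : opens T := Opens (@openT T).

Lemma opens_subT (T : topologicalType) (U : opens T) : U `<=` opensT T.
Proof. by []. Qed.

Definition is_sheaf (T : topologicalType) (F : opens T -> Type)
    (res : forall U V : opens T, V `<=` U -> F U -> F V) : Prop :=
  forall (U : opens T) (J : Type) (V : J -> opens T)
         (VU : forall j, V j `<=` U),
    U `<=` \bigcup_j V j ->
    forall s : (forall j, F (V j)),
      (forall i j (W : opens T) (Wi : W `<=` V i) (Wj : W `<=` V j),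
          res _ _ Wi (s i) = res _ _ Wj (s j)) ->
      exists! t : F U, forall j, res _ _ (VU j) t = s j.

(* Rings of sections may be the zero ring (e.g. over the empty set). *)
Record ringedSpace := RingedSpace {
  rs_top :> topologicalType;
  sec : opens rs_top -> comPzRingType;
  rho : forall U V : opens rs_top, V `<=` U -> {rmorphism sec U -> sec V};
  rho_id : forall (U : opens rs_top) (UU : U `<=` U) (s : sec U),
    rho UU s = s;
  rho_comp : forall (U V W : opens rs_top)
      (VU : V `<=` U) (WV : W `<=` V) (WU : W `<=` U) (s : sec U),
    rho WV (rho VU s) = rho WU s;
  rs_sheaf : is_sheaf (fun U V VU => rho VU : sec U -> sec V)
}.
Arguments sec {_} _.
Arguments rho {_ _ _} _.

Notation "'\O' U" := (sec U) (at level 8, U at level 8).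

Definition rhoT (X : ringedSpace) (U : opens X) :
    {rmorphism \O (opensT X) -> \O U} :=
  rho (@opens_subT X U).

(* (U, O|U) is isomorphic to Spec (O U): [phi] is a homeomorphism of the
   spectrum onto [U], under which the sections over basic opens are the
   localizations of [O U], the restriction maps being the localization maps;
   these are the defining values of the structure sheaf of a spectrum on the
   base of its basic open sets. *)
Definition affine (X : ringedSpace) (U : opens X) : Prop :=
  exists phi : Spec (\O U) -> X,
    [/\ injective phi,
        range phi = U,
        continuous phi,
        forall W : set (Spec (\O U)), open W -> open (phi @` W) &
        forall (a : \O U) (V : opens X) (VU : V `<=` U),
          phi @` basic_open a = V -> is_localization (rho VU) a].

Record scheme := Scheme {
  sch_rs :> ringedSpace;
  sch_affine : forall x : sch_rs, exists U : opens sch_rs, oset U x /\ affine U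
}.

(* The germ of [s] at [x] is a unit of the stalk at [x]. *)
Definition germ_unit (X : ringedSpace) (U : opens X) (s : \O U) (x : X) :
    Prop :=
  exists (V : opens X) (VU : V `<=` U),
    oset V x /\ exists t : \O V, rho VU s * t = 1.

Definition preim_opens (S T : topologicalType) (f : S -> T)
    (fc : continuous f) (U : opens T) : opens S :=
  Opens (proj1 (@continuousP _ _ f) fc U (opens_open U)).

Lemma preim_sub (S T : topologicalType) (f : S -> T) (fc : continuous f)
    (U V : opens T) :
  V `<=` U -> preim_opens fc V `<=` preim_opens fc U.
Proof. by move=> VU x; exact: VU. Qed.

Lemma preim_subT (S T : topologicalType) (f : S -> T) (fc : continuous f) :
  opensT S `<=` preim_opens fc (opensT T).
Proof. by []. Qed.

Arguments preim_sub {S T f} fc {U V} _.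
Arguments preim_subT {S T f} fc.

Record morphism (X Y : ringedSpace) := Morphism {
  mor_fun :> X -> Y;
  mor_cont : continuous mor_fun;
  mor_sharp : forall U : opens Y,
    {rmorphism \O U -> \O (preim_opens mor_cont U)};
  mor_nat : forall (U V : opens Y) (VU : V `<=` U) (s : \O U),
    mor_sharp V (rho VU s) = rho (preim_sub mor_cont VU) (mor_sharp U s);
  mor_local : forall (U : opens Y) (s : \O U) (x : X), oset U (mor_fun x) ->
    germ_unit (mor_sharp U s) x -> germ_unit s (mor_fun x)
}.

Arguments mor_cont {X Y} _.
Arguments mor_sharp {X Y} _ U.

Notation preimO f := (preim_opens (mor_cont f)).

Definition sharpT (X Y : ringedSpace) (f : morphism X Y) :
    \O (opensT Y) -> \O (opensT X) :=
  fun s => rho (preim_subT (mor_cont f)) (mor_sharp f _ s).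

(* h = g \o f, as morphisms of ringed spaces. *)
Definition is_comp (X Y Z : ringedSpace) (g : morphism Y Z)
    (f : morphism X Y) (h : morphism X Z) : Prop :=
  (forall x, h x = g (f x)) /\
  forall (U : opens Z) (W : opens X)
         (Wgf : W `<=` preimO f (preimO g U)) (Wh : W `<=` preimO h U)
         (s : \O U),
    rho Wh (mor_sharp h U s) = rho Wgf (mor_sharp f _ (mor_sharp g U s)).

Definition is_id (X : ringedSpace) (f : morphism X X) : Prop :=
  (forall x, f x = x) /\
  forall (U W : opens X) (Wf : W `<=` preimO f U) (WU : W `<=` U) (s : \O U),
    rho Wf (mor_sharp f U s) = rho WU s.

Definition closed_immersion (X Y : ringedSpace) (i : morphism X Y) : Prop :=
  [/\ injective i,
      forall Z : set X, closed Z -> closed (i @` Z) &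
      forall (U : opens Y) (s : \O (preimO i U)) (y : Y), oset U y ->
        exists (V : opens Y) (VU : V `<=` U), oset V y /\
          exists t : \O V,
            mor_sharp i V t = rho (preim_sub (mor_cont i) VU) s].

(* A morphism to Spec A is the same thing as a ring morphism from A to the
   global sections. *)
Record schemeOver (A : comPzRingType) := SchemeOver {
  so_sch :> scheme;
  so_str : {rmorphism A -> \O (opensT so_sch)}
}.

(* f commutes with the structure morphisms over phi : A -> B. *)
Definition morphism_over (A B : comPzRingType) (phi : {rmorphism A -> B})
    (X : schemeOver B) (Y : schemeOver A) (f : morphism X Y) : Prop :=
  forall a : A, sharpT f (so_str Y a) = so_str X (phi a).

Definition is_base_change (A B : comPzRingType) (phi : {rmorphism A -> B})
    (Y : schemeOver A) (Y' : schemeOver B) (p : morphism Y' Y) : Prop :=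
  morphism_over phi p /\
  forall (T : schemeOver B) (f : morphism T Y), morphism_over phi f ->
    exists! h : morphism T Y', morphism_over idfun h /\ is_comp p h f.

Definition is_product (A : comPzRingType) (Y1 Y2 P : schemeOver A)
    (p1 : morphism P Y1) (p2 : morphism P Y2) : Prop :=
  [/\ morphism_over idfun p1, morphism_over idfun p2 &
      forall (T : schemeOver A) (f1 : morphism T Y1) (f2 : morphism T Y2),
        morphism_over idfun f1 -> morphism_over idfun f2 ->
        exists! h : morphism T P,
          [/\ morphism_over idfun h, is_comp p1 h f1 & is_comp p2 h f2]].

Definition separated_over (A : comPzRingType) (Y : schemeOver A) : Prop :=
  exists (P : schemeOver A) (p1 p2 : morphism P Y) (delta : morphism Y P)
         (one : morphism Y Y),
    [/\ is_product p1 p2, is_id one,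
        is_comp p1 delta one, is_comp p2 delta one & closed_immersion delta].

Definition finite_type (A : comPzRingType) (Y : schemeOver A) : Prop :=
  exists (n : nat) (U : 'I_n -> opens Y),
    (forall y : Y, exists j, oset (U j) y) /\
    forall j, affine (U j) /\
      finite_type_algebra (rhoT (U j) \o so_str Y : {rmorphism A -> \O (U j)}).

Definition variety (k : fieldType) (Y : schemeOver k) : Prop :=
  separated_over Y /\ finite_type Y.

Definition integral_scheme (Y : scheme) : Prop :=
  (exists y : Y, True) /\
  forall U : opens Y, U !=set0 -> integral_domain (\O U).

Section Dimension.
Variable T : topologicalType.

Definition irreducible_closed (Z : set T) : Prop :=
  [/\ closed Z, Z !=set0 &
      forall A B : set T, closed A -> closed B -> Z `<=` A `|` B ->
        Z `<=` A \/ Z `<=` B].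

Definition irreducible_chain (n : nat) : Prop :=
  exists Z : nat -> set T,
    (forall i, (i <= n)%N -> irreducible_closed (Z i)) /\
    (forall i, (i < n)%N -> Z i `<` Z i.+1).

(* The empty space, of dimension minus infinity, satisfies this for no d. *)
Definition has_dim (d : nat) : Prop :=
  irreducible_chain d /\ forall n, irreducible_chain n -> (n <= d)%N.

End Dimension.

Record modSheaf (X : ringedSpace) := ModSheaf {
  msec :> forall U : opens X, lmodType (\O U);
  mres : forall U V : opens X, V `<=` U -> msec U -> msec V;
  mres_lin : forall (U V : opens X) (VU : V `<=` U) (a : \O U)
      (s t : msec U),
    mres VU (a *: s + t) = rho VU a *: mres VU s + mres VU t;
  mres_id : forall (U : opens X) (UU : U `<=` U) (s : msec U),
    mres UU s = s;
  mres_comp : forall (U V W : opens X)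
      (VU : V `<=` U) (WV : W `<=` V) (WU : W `<=` U) (s : msec U),
    mres WV (mres VU s) = mres WU s;
  ms_sheaf : is_sheaf (fun U V VU => @mres U V VU)
}.
Arguments mres {_ _ _ _} _.

Section Modules.
Variable X : ringedSpace.

Lemma str_lin (U V : opens X) (VU : V `<=` U) (a : \O U) (s t : (\O U)^o) :
  (rho VU (a *: s + t) : (\O V)^o) = rho VU a *: (rho VU s : (\O V)^o) + rho VU t.
Proof. by rewrite rmorphD rmorphM. Qed.

Definition strSheaf : modSheaf X :=
  @ModSheaf X (fun U => (\O U)^o) (fun U V VU => rho VU) str_lin
    (@rho_id X) (@rho_comp X) (@rs_sheaf X).

Record modHom (L N : modSheaf X) := ModHom {
  mh_fun :> forall U, L U -> N U;
  mh_lin : forall U, linear (@mh_fun U);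
  mh_nat : forall (U V : opens X) (VU : V `<=` U) (s : L U),
    mh_fun (mres VU s) = mres VU (mh_fun s)
}.

Arguments mh_fun {L N} _ U _.

Definition is_iso (L N : modSheaf X) (h : modHom L N) : Prop :=
  forall U, bijective (h U).

Record biHom (L L' N : modSheaf X) := BiHom {
  bh_fun :> forall U, L U -> L' U -> N U;
  bh_linl : forall U (t : L' U), linear (fun s => bh_fun s t);
  bh_linr : forall U (s : L U), linear (fun t => bh_fun s t);
  bh_nat : forall (U V : opens X) (VU : V `<=` U) (s : L U) (t : L' U),
    bh_fun (mres VU s) (mres VU t) = mres VU (bh_fun s t)
}.

Arguments bh_fun {L L' N} _ U _ _.

(* [b] is a universal bilinear map, i.e. the morphism from the tensor product
   of L and L' to N which it induces is an isomorphism. *)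
Definition is_tensor (L L' N : modSheaf X) (b : biHom L L' N) : Prop :=
  forall (Q : modSheaf X) (c : biHom L L' Q),
    exists! h : modHom N Q,
      forall U (s : L U) (t : L' U), h U (b U s t) = c U s t.

Definition trivializes (L : modSheaf X) (V : opens X) (e : L V) : Prop :=
  forall (W : opens X) (WV : W `<=` V) (t : L W),
    exists! a : \O W, t = a *: mres WV e.

Definition invertible (L : modSheaf X) : Prop :=
  forall x : X, exists V : opens X, oset V x /\ exists e : L V, trivializes e.

Definition ideal_family := forall U : opens X, set (\O U).

Definition ideal_le (I J : ideal_family) : Prop := forall U, I U `<=` J U.

(* The sheaf sum: sections which are locally sums of sections. *)
Definition ideal_sum (s : nat) (I : 'I_s -> ideal_family) : ideal_family :=
  fun U => [set a | forall x : X, oset U x ->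
    exists (V : opens X) (VU : V `<=` U), oset V x /\
      exists t : 'I_s -> \O V,
        (forall j, I j V (t j)) /\ rho VU a = \sum_(j < s) t j].

Definition ideal_supp (I : ideal_family) : set X :=
  [set x | ~ exists U : opens X, oset U x /\ I U 1].

(* The ideal sheaf of the scheme of zeros of a global section t of L: if e
   trivializes L and t = b e, this is locally the ideal generated by b. *)
Definition zero_ideal (L : modSheaf X) (t : L (opensT X)) : ideal_family :=
  fun U => [set a | forall x : X, oset U x ->
    exists (V : opens X) (VU : V `<=` U), oset V x /\
      exists (e : L V) (b c : \O V),
        [/\ trivializes e,
            mres (@opens_subT X V) t = b *: e &
            rho VU a = c * b]].

End Modules.
Arguments ideal_sum {X s} I U.
Arguments zero_ideal {X L} t U.

Definition ker_ideal (X Y : ringedSpace) (i : morphism X Y) :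
    ideal_family Y :=
  fun U => [set a | mor_sharp i U a = 0].

Arguments ker_ideal {X Y} i U.

(* The class in Pic(X) of L is the collection of all sheaves isomorphic to L. *)
Definition pic_class (X : ringedSpace) (L : modSheaf X) : modSheaf X -> Prop :=
  fun N => exists h : modHom L N, is_iso h.

(* A subgroup of Pic(X), as an abstract group with an injective morphism to
   Pic(X), whose group law is induced by the tensor product. *)
Record picSubgroup (X : ringedSpace) := PicSubgroup {
  ps_group :> zmodType;
  ps_class : ps_group -> modSheaf X -> Prop;
  ps_classP : forall m,
    exists L : modSheaf X, invertible L /\ ps_class m = pic_class L;
  ps_inj : injective ps_class;
  ps_class0 : ps_class 0 = pic_class (strSheaf X);
  ps_classD : forall (m n : ps_group) (L L' N : modSheaf X),
    ps_class m L -> ps_class n L' -> ps_class (m + n) N ->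
    exists b : biHom L L' N, is_tensor b
}.

(* The target degree p of the multiplication is decoupled from m + n so that
   commutativity and associativity are well-typed without casts. *)
Record gradedAlgebra (X : ringedSpace) (M : zmodType) := GradedAlgebra {
  ga_sheaf :> M -> modSheaf X;
  ga_mul : forall m n p : M, m + n = p ->
    biHom (ga_sheaf m) (ga_sheaf n) (ga_sheaf p);
  ga_mulC : forall (m n p : M) (e : m + n = p) (e' : n + m = p)
      U (s : ga_sheaf m U) (t : ga_sheaf n U),
    ga_mul e U s t = ga_mul e' U t s;
  ga_mulA : forall (m n p mn np q : M) (e1 : m + n = mn) (e2 : mn + p = q)
      (e3 : n + p = np) (e4 : m + np = q)
      U (s : ga_sheaf m U) (t : ga_sheaf n U) (u : ga_sheaf p U),
    ga_mul e2 U (ga_mul e1 U s t) u = ga_mul e4 U s (ga_mul e3 U t u);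
  (* the identification of the structure sheaf with the degree 0 part *)
  ga_unit : modHom (strSheaf X) (ga_sheaf 0);
  ga_unit_iso : is_iso ga_unit;
  ga_unitP : forall (m : M) (e : 0 + m = m) U (a : \O U) (t : ga_sheaf m U),
    ga_mul e U (ga_unit U a) t = a *: t
}.

Record coxRing (k : fieldType) (Y : schemeOver k) (M : picSubgroup Y) :=
    CoxRing {
  cox_sheaf : gradedAlgebra Y M;
  cox_inv : forall m, invertible (cox_sheaf m);
  cox_class : forall m, ps_class m (cox_sheaf m);
  cox_tensor : forall m n, is_tensor (ga_mul cox_sheaf (erefl (m + n)));
  cox_ring :> comAlgType k;
  (* the ring is the direct sum of the images of the maps [cox_in m] *)
  cox_in : forall m, {additive cox_sheaf m (opensT Y) -> cox_ring};
  cox_gen : forall r : cox_ring,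
    exists (D : seq M) (s : forall m, cox_sheaf m (opensT Y)),
      r = \sum_(m <- D) cox_in m (s m);
  cox_free : forall (D : seq M) (s : forall m, cox_sheaf m (opensT Y)),
    uniq D -> \sum_(m <- D) cox_in m (s m) = 0 ->
    forall m, m \in D -> s m = 0;
  cox_in1 : cox_in 0 (ga_unit cox_sheaf _ 1) = 1;
  cox_inM : forall (m n p : M) (e : m + n = p)
      (s : cox_sheaf m (opensT Y)) (t : cox_sheaf n (opensT Y)),
    cox_in p (ga_mul cox_sheaf e _ s t) = cox_in m s * cox_in n t;
  cox_inZ : forall (m : M) (c : k) (s : cox_sheaf m (opensT Y)),
    cox_in m (so_str Y c *: s) = c *: cox_in m s
}.

Section CoxRings.
Variables (k : fieldType) (Y : schemeOver k) (M : picSubgroup Y).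
Variable R : coxRing M.

Definition homogeneous (f : R) : Prop :=
  exists (m : M) (t : cox_sheaf R m (opensT Y)), f = cox_in R m t.

(* The ideal sheaf O(-D_f), for f homogeneous and nonzero. *)
Definition div_ideal (f : R) : ideal_family Y :=
  fun U => [set a | exists (m : M) (t : cox_sheaf R m (opensT Y)),
    f = cox_in R m t /\ zero_ideal t U a].

Definition psi (I : ideal_family Y) : set R :=
  ideal_gen [set f : R |
    [/\ homogeneous f, f != 0 & ideal_le (div_ideal f) I]].

End CoxRings.
Arguments div_ideal {k Y M R} f U.
Arguments psi {k Y M} R I _.

(* The closed subscheme X is given with its closed immersion i. *)
Definition complete_intersection (X Y : ringedSpace) (i : morphism X Y)
    (s : nat) (H : 'I_s -> ideal_family Y) : Prop :=
  (exists d : nat, has_dim X d /\ has_dim Y (d + s)) /\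
  forall U, ker_ideal i U = ideal_sum H U.

(* Codimension s, in the sense dim X + s = dim Y, is part of
   [complete_intersection]. *)
Definition strict_complete_intersection (k : fieldType) (Y : schemeOver k)
    (M : picSubgroup Y) (R : coxRing M) (X : ringedSpace) (i : morphism X Y)
    (s : nat) (f : 'I_s -> R) : Prop :=
  complete_intersection i (fun j => div_ideal (f j)) /\
  psi R (ker_ideal i) = ideal_gen (range f).

(* The complements of the supports of the D_g cover Y, and each of them is
   contained in a member of some affine open covering. *)
Definition refines_affine_covering (k : fieldType) (Y : schemeOver k)
    (M : picSubgroup Y) (R : coxRing M) (m : nat) (g : 'I_m -> R) : Prop :=
  (forall y : Y, exists j, (~` ideal_supp (div_ideal (g j))) y) /\
  exists C : set (opens Y),
    [/\ forall U, C U -> affine U,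
        forall y : Y, exists U, C U /\ oset U y &
        forall j, exists U, C U /\ ~` ideal_supp (div_ideal (g j)) `<=` U].

(* Main.v *)
(* Write f_j, g_j for sections of the invertible sheaves L of the Cox ring. The
   claim is psi(I_X) = ((f) : (g)^oo) whenever I_X is the sum of the ideal
   sheaves of the D_{f_j}; both sides are generated by homogeneous elements.
   If t g_j^N is a combination of the f_i for all j, then, since g_j generates
   its sheaf on the complement of D_{g_j} and these complements cover Y,
   expressing everything in local generators gives O(-D_t) <= I_X.
   Conversely, if O(-D_t) <= I_X, then t is locally a combination of the f_i
   with coefficients in the L's. On an affine open U containing the complement
   of D_{g_j} the functions a such that a t is such a combination form an ideal
   contained in no prime, so t itself is a combination on U; after
   multiplication by a power of g_j the coefficients extend to Y, by
   quasi-compactness and because restriction to a nonempty open subset is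
   injective on an integral scheme.
   Products of local generators are local generators because the multiplication
   maps are universal bilinear maps. *)

Require Import Defs.
From HB Require Import structures.
From mathcomp Require Import all_boot all_order all_algebra.
From mathcomp Require Import ring.
From mathcomp Require Import mathcomp_extra boolp classical_sets topology.

Import GRing.Theory.
Local Open Scope classical_set_scope.
Local Open Scope ring_scope.

Set Implicit Arguments.
Unset Strict Implicit.
Unset Printing Implicit Defensive.

(** * Ideals and prime ideals *)

Section Ideals.
Variable A : comPzRingType.
Implicit Types (I G S : set A) (p : Spec A).

Record is_ideal I : Prop := IsIdeal {
  ideal0 : I 0;
  idealD : forall x y, I x -> I y -> I (x + y);
  idealM : forall a x, I x -> I (a * x)
}.

Lemma ideal_sumr I (J : Type) (r : seq J) (x : J -> A) : is_ideal I ->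
  (forall j, I (x j)) -> I (\sum_(j <- r) x j).
Proof. by move=> iI Ix; elim/big_ind: _ => //; case: iI. Qed.

Lemma Spec_ideal p : is_ideal p.
Proof. by split; [exact: spec0 | exact: specD | exact: specM]. Qed.

Lemma ideal_genP S : is_ideal (ideal_gen S).
Proof.
split.
- by exists 0%N, (fun=> 0), (fun=> 0); split; [case | rewrite big_ord0].
- move=> _ _ [m [a [x [Sx ->]]]] [n [b [y [Sy ->]]]]; exists (m + n)%N.
  exists (fun i => match split i with inl j => a j | inr j => b j end).
  exists (fun i => match split i with inl j => x j | inr j => y j end).
  split; first by move=> i; case: (split i).
  rewrite big_split_ord /=; congr (_ + _); apply: eq_bigr => i _.
    by rewrite -[lshift _ _]/(unsplit (inl i)) unsplitK.
  by rewrite -[rshift _ _]/(unsplit (inr i)) unsplitK.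
- move=> c _ [m [a [x [Sx ->]]]]; exists m, (fun i => c * a i), x; split=> //.
  by rewrite mulr_sumr; apply: eq_bigr => i _; rewrite mulrA.
Qed.

Lemma sub_ideal_gen S : S `<=` ideal_gen S.
Proof.
move=> x Sx; exists 1%N, (fun=> 1), (fun=> x); split=> //.
by rewrite big_ord1 mul1r.
Qed.

Lemma ideal_gen_min S I : is_ideal I -> S `<=` I -> ideal_gen S `<=` I.
Proof.
move=> iI SI _ [m [a [x [Sx ->]]]]; apply: ideal_sumr => // i.
by apply: idealM => //; exact: SI.
Qed.

Lemma ideal_gen_range s (f : 'I_s -> A) r :
  ideal_gen (range f) r -> exists a, r = \sum_(j < s) a j * f j.
Proof.
apply: (ideal_gen_min (I := [set r | exists a, r = \sum_(j < s) a j * f j])).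
  split.
  - by exists (fun=> 0); rewrite big1 // => j _; rewrite mul0r.
  - move=> _ _ [a ->] [b ->]; exists (fun j => a j + b j).
    by rewrite -big_split; apply: eq_bigr => j _; rewrite mulrDl.
  - move=> c _ [a ->]; exists (fun j => c * a j).
    by rewrite mulr_sumr; apply: eq_bigr => j _; rewrite mulrA.
move=> _ [i _ <-]; exists (fun j => (j == i)%:R).
rewrite (bigD1 i) //= eqxx mul1r big1 ?addr0 // => j /negbTE->.
by rewrite mul0r.
Qed.

Lemma sum_ideal_gen s (f a : 'I_s -> A) :
  ideal_gen (range f) (\sum_j a j * f j).
Proof.
apply: ideal_sumr => [|j]; first exact: ideal_genP.
by apply: (idealM (ideal_genP _)); apply: sub_ideal_gen; exists j.
Qed.

(** An ideal maximal among those that contain [I] and no power of [x] is prime; Zorn's lemma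
    provides one. *)
Lemma exists_prime_avoiding I x : is_ideal I -> (forall n, ~ I (x ^+ n)) ->
  exists p, I `<=` p /\ ~ spec_ideal p x.
Proof.
move=> iI Ix.
(* the empty set is added to make room for the union of the empty chain *)
pose Q J := J = set0 \/ [/\ is_ideal J, I `<=` J & forall n, ~ J (x ^+ n)].
have [J [QJ maxJ]] : exists J, Q J /\ forall K, J `<` K -> ~ Q K.
  apply: Zorn_bigcup => F FQ tF.
  have [[K FK K0]|F0] := pselect (exists2 K, F K & K !=set0); last first.
    left; apply/seteqP; split=> // y [K FK Ky].
    by case: F0; exists K => //; exists y.
  have QF L y : F L -> L y ->
      [/\ is_ideal L, I `<=` L & forall n, ~ L (x ^+ n)].
    by move=> FL Ly; case: (FQ _ FL) => // L0; rewrite L0 in Ly.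
  case: K0 => z Kz; have [iK IK _] := QF _ _ FK Kz.
  right; split; first split.
  - by exists K => //; exact: ideal0.
  - move=> a b [K1 F1 K1a] [K2 F2 K2b].
    have [iK1 _ _] := QF _ _ F1 K1a; have [iK2 _ _] := QF _ _ F2 K2b.
    case: (tF _ _ F1 F2) => s12; [exists K2 | exists K1] => //.
      by apply: idealD => //; exact: s12.
    by apply: idealD => //; exact: s12.
  - move=> a b [K1 F1 K1b]; exists K1 => //.
    by have [iK1 _ _] := QF _ _ F1 K1b; exact: idealM.
  - by move=> a Ia; exists K => //; exact: IK.
  - by move=> n [K1 F1 K1x]; have [_ _ /(_ n)] := QF _ _ F1 K1x.
(* [I] satisfies [Q] and contains 0, so a maximal [J] is not the empty set. *)
have {QJ} [iJ IJ Jx] : [/\ is_ideal J, I `<=` J & forall n, ~ J (x ^+ n)].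
  case: QJ => // J0; exfalso; apply: (maxJ I); last by right; split.
  by rewrite J0; split=> // /(_ _ (ideal0 iI)).
(* Maximality is applied to the ideal generated by [J] and [y]. *)
have Jmax y : ~ J y -> exists n a j, J j /\ x ^+ n = j + a * y.
  move=> nJy; apply: contrapT => nex.
  pose K := [set z | exists j a, J j /\ z = j + a * y].
  apply: (maxJ K).
    split=> [z Jz|KJ]; first by exists z, 0; split=> //; rewrite mul0r addr0.
    by apply: nJy; apply: KJ; exists 0, 1; split;
       [exact: ideal0 | rewrite mul1r add0r].
  right; split; first split.
  - by exists 0, 0; split; [exact: ideal0 | rewrite mul0r addr0].
  - move=> _ _ [j [a [Jj ->]]] [j' [a' [Jj' ->]]].
    by exists (j + j'), (a + a'); split; [exact: idealD | ring].
  - move=> c _ [j [a [Jj ->]]].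
    by exists (c * j), (c * a); split; [exact: idealM | ring].
  - move=> z Iz; exists z, 0; split; first exact: IJ.
    by rewrite mul0r addr0.
  - by move=> n [j [a [Jj e]]]; apply: nex; exists n, a, j.
have J1 : ~ J 1 by have := Jx 0%N; rewrite expr0.
have Jprime y z : J (y * z) -> J y \/ J z.
  move=> Jyz; apply: contrapT => /not_orP[/Jmax[n [a [j [Jj e]]]]].
  move=> /Jmax[n' [a' [j' [Jj' e']]]]; apply: (Jx (n + n')%N).
  have -> : x ^+ (n + n') = (a' * z + j') * j + (a * y) * j' + a * a' * (y * z).
    by rewrite exprD e e'; ring.
  by apply: (idealD iJ); [apply: (idealD iJ)|]; exact: idealM.
exists (MkSpec (ideal0 iJ) (idealD iJ) (idealM iJ) J1 Jprime); split=> //.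
by have := Jx 1%N; rewrite expr1.
Qed.

Lemma radicalP I x : is_ideal I ->
  (forall p, I `<=` p -> spec_ideal p x) -> exists n, I (x ^+ n).
Proof.
move=> iI Ip; apply: contrapT => nI.
have [n In|p [/Ip px /(_ px)]] := exists_prime_avoiding iI (x := x); last by [].
by apply: nI; exists n.
Qed.

Lemma gen_ideal_pow s (g : 'I_s -> A) j N :
  ideal_pow (ideal_gen (range g)) N (g j ^+ N).
Proof.
elim: N => //= N IHN; apply: sub_ideal_gen.
exists (g j ^+ N), (g j); split; rewrite -?exprSr //.
by apply: sub_ideal_gen; exists j.
Qed.

(* Pigeonhole: a monomial of degree greater than s * N in s variables has an
   exponent at least N. *)
Lemma ideal_pow_sub s (g : 'I_s -> A) I N : is_ideal I ->
  (forall j, I (g j ^+ N)) ->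
  exists K, ideal_pow (ideal_gen (range g)) K `<=` I.
Proof.
move=> iI Ig.
(* Induction on [K]; the exponents [n] collect the powers of the [g j] already split off. *)
suff H K (n : 'I_s -> nat) : (s * N < \sum_j n j + K)%N ->
    forall x, ideal_pow (ideal_gen (range g)) K x -> I (x * \prod_j g j ^+ n j).
  exists (s * N).+1 => x /(H _ (fun=> 0%N)).
  by rewrite !big1 ?mulr1 //; apply; rewrite add0n.
elim: K n => [|K IHK] n ltn x.
  move=> _; rewrite addn0 in ltn.
  have [j Nj] : exists j, (N <= n j)%N.
    apply: contrapT => nN; suff : (\sum_j n j <= s * N)%N by rewrite leqNgt ltn.
    rewrite -[s in (s * _)%N]card_ord -sum_nat_const; apply: leq_sum => j _.
    by rewrite leqNgt; apply/negP => /ltnW Nj; apply: nN; exists j.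
  rewrite (bigD1 j) //= -(subnK Nj) exprD.
  set b := \prod_(i < s | _) _.
  rewrite (_ : _ * _ = x * g j ^+ (n j - N) * b * g j ^+ N); last by ring.
  exact: idealM.
move=> /= [q [a [z [zP ->]]]]; rewrite mulr_suml; apply: ideal_sumr => // i.
rewrite -mulrA; apply: idealM => //.
have [u [v [uK vG ->]]] := zP i; have [c ->] := ideal_gen_range vG.
rewrite mulr_sumr mulr_suml; apply: ideal_sumr => // l.
set n' := fun j => ((j == l) + n j)%N.
rewrite (_ : _ * _ * _ = c l * (u * \prod_j g j ^+ n' j)).
  apply: idealM => //; apply: IHK => //; rewrite big_split /=.
  rewrite (bigD1 l) //= eqxx big1 => [|j /negbTE->] //.
  by rewrite addn0 add1n addSnnS.
have -> : \prod_j g j ^+ n' j = g l * \prod_j g j ^+ n j.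
  rewrite (bigD1 l) //= [in RHS](bigD1 l) //= mulrA {1}/n' eqxx add1n exprS.
  by congr (_ * _); apply: eq_bigr => j /negbTE jl; rewrite /n' jl.
by ring.
Qed.

Lemma saturation_ideal I G : is_ideal I -> is_ideal (saturation I G).
Proof.
move=> iI; split.
- by exists 0%N => g _; rewrite mul0r; exact: ideal0.
(* Exponents may be raised, so the two summands can share one. *)
- have mono N K x : (forall g, ideal_pow G N g -> I (x * g)) ->
      forall g, ideal_pow G (K + N) g -> I (x * g).
    move=> H; elim: K => // K IHK g [q [a [z [zP ->]]]].
    rewrite mulr_sumr; apply: ideal_sumr => // i.
    have [u [v [uK _ ->]]] := zP i.
    rewrite (_ : _ * _ = a i * v * (x * u)); last by ring.
    by apply: idealM => //; exact: IHK.
  move=> x y [N Nx] [K Ky]; exists (K + N)%N => g gKN; rewrite mulrDl.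
  by apply: idealD => //; [exact: mono gKN | apply: (mono _ N _ Ky);
    rewrite addnC].
- move=> a x [N Nx]; exists N => g gN; rewrite -mulrA.
  by apply: idealM => //; exact: Nx.
Qed.

End Ideals.

(** * Open subsets and affine charts *)

Section Opens.
Variable T : topologicalType.
Implicit Types (U V W : opens T) (y : T) (P Q : opens T -> Prop).

Definition capO U V : opens T := Opens (openI (opens_open U) (opens_open V)).

Definition cupO (J : Type) (D : J -> opens T) : opens T :=
  Opens (bigcup_open (fun (j : J) (_ : setT j) => opens_open (D j))).

(** Asking for all smaller neighbourhoods, and not for a single one, lets finitely many such
    conditions be met on the same set. *)
Definition nearby y P := exists V, oset V y /\ forall W, W `<=` V -> oset W y -> P W.

Lemma nearby_in U y : oset U y -> nearby y (fun W => W `<=` U).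
Proof. by move=> Uy; exists U. Qed.

Lemma nearby_and y P Q :
  nearby y P -> nearby y Q -> nearby y (fun W => P W /\ Q W).
Proof.
move=> [U [Uy PU]] [V [Vy QV]]; exists (capO U V); split=> // W WUV Wy.
by split; [apply: PU | apply: QV] => // z /WUV[].
Qed.

Lemma nearby_all n y (P : 'I_n -> opens T -> Prop) :
  (forall i, nearby y (P i)) -> nearby y (fun W => forall i, P i W).
Proof.
move=> /choice[V VP].
have [W [Wy WV]] : exists W, oset W y /\ forall i, i \in enum 'I_n -> W `<=` V i.
  elim: (enum 'I_n) => [|i r [W [Wy WV]]]; first by exists (opensT T).
  exists (capO (V i) W); split=> [|j]; first by split=> //; have [] := VP i.
  by rewrite inE => /orP[/eqP-> z []|/WV jW z [_ /jW]].
exists W; split=> // W' W'W W'y i; apply: (VP i).2 => // z /W'W.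
by apply: WV; rewrite mem_enum.
Qed.

Lemma nearby_ex y P : nearby y P -> exists W, oset W y /\ P W.
Proof. by move=> [V [Vy VP]]; exists V; split=> //; exact: VP. Qed.

(** The cover is given by a property of open sets, so that a local existence statement serves
    directly as a cover. *)
Definition qcompact W := forall P,
  (forall y, oset W y -> exists D, [/\ P D, oset D y & D `<=` W]) ->
  exists (J : finType) (D : J -> opens T),
    (forall j, P (D j) /\ D j `<=` W) /\ W `<=` \bigcup_j D j.

Lemma qcompact_cover n (U : 'I_n -> opens T) : (forall j, qcompact (U j)) ->
  (forall y, exists j, oset (U j) y) -> qcompact (opensT T).
Proof.
move=> qU covU P PP.
have H j : exists x : {J : finType & J -> opens T},
    (forall i, exists2 D, P D & tagged x i `<=` D) /\
    U j `<=` \bigcup_i tagged x i.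
  (* [P] need not pass to smaller open sets, so the pieces inside [U j] are only required to lie in
     a set that has it. *)
  have [|J [D [DP UD]]] := qU j (fun D => exists2 D', P D' & D `<=` D').
    move=> y Uy; have [//|D [PD Dy _]] := PP y; exists (capO D (U j)).
    by split=> [| |z []] //; exists D => // z [].
  by exists (Tagged (fun J : finType => J -> opens T) D); split=> // i;
     have [] := DP i.
have [x xP] := choice H.
have H' (k : {j & tag (x j)}) :
    exists D, P D /\ tagged (x (tag k)) (tagged k) `<=` D.
  by case: k => j i; have [/(_ i)[D PD kD] _] := xP j; exists D.
have [D DP] := choice H'; exists {j : 'I_n & tag (x j)}, D.
split=> [k|y _]; first by split; [exact: (DP k).1|].
have [j /(xP j).2[i _ yi]] := covU y.
by exists (Tagged (fun j => tag (x j)) i) => //; exact: (DP _).2.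
Qed.

End Opens.

(** The facts about an affine chart on which later arguments rest, freed from the spectrum: [bo_pt]
    is what remains of the prime ideal at [y], and [bo_rad] of the description of radicals by
    primes. *)
Record basic_opens (X : ringedSpace) (U : opens X) (D : \O U -> opens X) :
    Prop := BasicOpens {
  bo_sub : forall a, D a `<=` U;
  bo_loc : forall a (V : opens X) (VU : V `<=` U),
    oset V = D a -> is_localization (rho VU) a;
  bo_basis : forall (V : opens X) y, V `<=` U -> oset V y ->
    exists a, oset (D a) y /\ D a `<=` V;
  bo_mul : forall a b y, oset (D (a * b)) y <-> oset (D a) y /\ oset (D b) y;
  bo_1 : U `<=` D 1;
  bo_pt : forall y, oset U y -> is_ideal [set a | ~ oset (D a) y];
  bo_rad : forall (I : set (\O U)) x, is_ideal I ->
    (forall y, oset (D x) y -> exists a, I a /\ oset (D a) y) ->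
    exists n, I (x ^+ n)
}.

Lemma affine_basic_opens (X : ringedSpace) (U : opens X) :
  affine U -> exists D, basic_opens (U := U) D.
Proof.
move=> [phi [phi_inj phi_im phi_cont phi_open phi_loc]].
have op a : open (phi @` basic_open a).
  by apply: phi_open; exists [set a]; rewrite bigcup_set1.
have DP a p : oset (Opens (op a)) (phi p) <-> ~ spec_ideal p a.
  by split=> [[q qa /phi_inj <-]//|pa]; exists p.
have phiU y : oset U y <-> exists p, phi p = y.
  by rewrite -phi_im; split=> [[p _ <-]|[p <-]]; exists p.
exists (fun a => Opens (op a)); split=> /=.
- by move=> a y [p _ <-]; apply/phiU; exists p.
- by move=> a V VU /esym; exact: phi_loc.
- move=> V y VU Vy; have [p py] := (phiU y).1 (VU _ Vy).
  have /continuousP /(_ _ (opens_open V)) [E EV] := phi_cont.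
  have : (phi @^-1` V) p by rewrite /= py.
  rewrite EV => -[a Ea pa]; exists a; split; first by exists p.
  by move=> _ [q qa <-]; rewrite -[oset V _]/((phi @^-1` V) q) EV; exists a.
- move=> a b y; split.
    move=> [p pab <-]; split; apply/DP => h; apply: pab.
      by rewrite mulrC; exact: specM.
    exact: specM.
  by move=> [[p pa <-]] /DP pb; exists p => // /spec_prime[].
- by move=> y /phiU[p <-]; exists p => //; exact: spec1.
- move=> y /phiU[p <-].
  rewrite (_ : [set a | _] = spec_ideal p); first exact: Spec_ideal.
  by apply/seteqP; split=> a /=; [move=> h; apply: contrapT => /DP | move=> pa /DP].
- move=> I x iI Ix; apply: radicalP => // p Ip; apply: contrapT => px.
  have [|a [Ia /DP]] := Ix (phi p); first by exists p.
  by apply; exact: Ip.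
Qed.

(** The case [x = 1] of [bo_rad]; it supplies partitions of unity. *)
Lemma basic_opens_cover (X : ringedSpace) (U : opens X) D
    (I : set (\O U)) : basic_opens D -> is_ideal I ->
  (forall y, oset U y -> exists a, I a /\ oset (D a) y) -> I 1.
Proof.
move=> bD iI IU; have [|n] := bo_rad bD (x := 1) iI; last by rewrite expr1n.
by move=> y /(bo_sub bD) /IU.
Qed.

Lemma affine_qcompact (X : ringedSpace) (U : opens X) : affine U -> qcompact U.
Proof.
move=> /affine_basic_opens[D bD] P PP.
pose E := [set a | exists V, [/\ P V, V `<=` U & D a `<=` V]].
have [|n [c [a [aE e]]]] := basic_opens_cover bD (ideal_genP E).
  move=> y Uy; have [V [PV Vy VU]] := PP y Uy.
  have [a [Day DaV]] := bo_basis bD VU Vy; exists a; split=> //.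
  by apply: sub_ideal_gen; exists V.
have [V VP] := choice aE; exists 'I_n, V.
split=> [j|y Uy]; first by have [] := VP j.
(* At a point outside every [V j] all the [a j] would vanish, and with them 1. *)
apply: contrapT => nV.
have iy := bo_pt bD Uy.
suff : [set a | ~ oset (D a) y] 1 by apply; exact: (bo_1 bD).
rewrite e; apply: ideal_sumr => // j; apply: (idealM iy) => /= Dy.
by apply: nV; exists j => //; have [_ _] := VP j; exact.
Qed.

(** * Restriction on integral schemes *)

Section Sheaves.
Variables (T : topologicalType) (F : opens T -> Type).
Variable res : forall U V : opens T, V `<=` U -> F U -> F V.
Hypothesis res_comp : forall (U V W : opens T)
    (VU : V `<=` U) (WV : W `<=` V) (WU : W `<=` U) (s : F U),
  res WV (res VU s) = res WU s.
Hypothesis F_sheaf : is_sheaf (@res).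

Lemma sheaf_ext (U : opens T) (s t : F U) :
  (forall y, oset U y -> exists (V : opens T) (VU : V `<=` U),
     oset V y /\ res VU s = res VU t) -> s = t.
Proof.
move=> H.
have H' (j : {y | oset U y}) : exists V : opens T,
    oset V (sval j) /\ exists VU : V `<=` U, res VU s = res VU t.
  by case: j => y /= /H[V [VU [Vy e]]]; exists V; split=> //; exists VU.
have [V VP] := choice H'.
have VU j : V j `<=` U by have [_ []] := VP j.
have VE j : res (VU j) s = res (VU j) t.
  by have [_ [VU' e]] := VP j; rewrite (Prop_irrelevance (VU j) VU').
have cov : U `<=` \bigcup_j V j.
  by move=> y Uy; exists (exist _ y Uy) => //; have [] := VP (exist _ y Uy).
have [i j W Wi Wj|r [_ runiq]] :=
    F_sheaf VU cov (s := fun j => res (VU j) s).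
  rewrite (res_comp _ _ (subset_trans Wi (VU i))).
  by rewrite (res_comp _ _ (subset_trans Wi (VU i))).
by rewrite -(runiq s) // -(runiq t) // => j; rewrite VE.
Qed.

End Sheaves.

Section RestrictionLemmas.
Variable X : ringedSpace.
Implicit Types (U V W : opens X) (L : modSheaf X).

Lemma rhoE U V (VU VU' : V `<=` U) (s : \O U) : rho VU s = rho VU' s.
Proof. by rewrite (Prop_irrelevance VU VU'). Qed.

Lemma sec_ext U (s t : \O U) :
  (forall y, oset U y -> exists (V : opens X) (VU : V `<=` U),
     oset V y /\ rho VU s = rho VU t) -> s = t.
Proof. exact: (sheaf_ext (@rho_comp X) (@rs_sheaf X)). Qed.

Lemma msec_ext L U (s t : L U) :
  (forall y, oset U y -> exists (V : opens X) (VU : V `<=` U),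
     oset V y /\ mres VU s = mres VU t) -> s = t.
Proof. exact: (sheaf_ext (@mres_comp X L) (@ms_sheaf X L)). Qed.

Lemma mresD L U V (VU : V `<=` U) (s t : L U) :
  mres VU (s + t) = mres VU s + mres VU t.
Proof. by have := mres_lin VU 1 s t; rewrite rmorph1 !scale1r. Qed.

Lemma mres0 L U V (VU : V `<=` U) : mres VU (0 : L U) = 0.
Proof.
by apply/(addrI (mres VU 0)); rewrite -mresD !addr0.
Qed.

Lemma mresZ L U V (VU : V `<=` U) a (s : L U) :
  mres VU (a *: s) = rho VU a *: mres VU s.
Proof. by have := mres_lin VU a s 0; rewrite !addr0 mres0 addr0. Qed.

Lemma mresN L U V (VU : V `<=` U) (s : L U) : mres VU (- s) = - mres VU s.
Proof. by rewrite -scaleN1r mresZ rmorphN1 scaleN1r. Qed.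

Lemma mresB L U V (VU : V `<=` U) (s t : L U) :
  mres VU (s - t) = mres VU s - mres VU t.
Proof. by rewrite mresD mresN. Qed.

Lemma mres_sum L U V (VU : V `<=` U) (J : Type) (r : seq J) (s : J -> L U) :
  mres VU (\sum_(j <- r) s j) = \sum_(j <- r) mres VU (s j).
Proof. by apply: (big_morph (mres VU)); [exact: mresD | exact: mres0]. Qed.

Lemma mresE L U V (VU VU' : V `<=` U) (s : L U) : mres VU s = mres VU' s.
Proof. by rewrite (Prop_irrelevance VU VU'). Qed.

Lemma trivializes_res L V W (WV : W `<=` V) (e : L V) :
  trivializes e -> trivializes (mres WV e).
Proof.
move=> te W' W'W t; rewrite (mres_comp _ _ (subset_trans W'W WV)).
exact: te.
Qed.

Lemma trivializes_coef L V (e : L V) (t : L V) :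
  trivializes e -> exists a, t = a *: e.
Proof.
by move=> /(_ V (@subset_refl _ _) t)[a [+ _]]; rewrite mres_id; exists a.
Qed.

Lemma trivializes_inj L V (e : L V) (a b : \O V) :
  trivializes e -> a *: e = b *: e -> a = b.
Proof.
move=> /(_ V (@subset_refl _ _) (a *: e))[c [_ cu]] eab.
by rewrite -(cu a) ?mres_id // -(cu b) ?mres_id.
Qed.

Lemma trivializes_unit L V (e : L V) (a c : \O V) :
  c * a = 1 -> trivializes e -> trivializes (a *: e).
Proof.
move=> ca te W WV t; have [b [tb bu]] := te W WV t.
have ca' : rho WV c * rho WV a = 1 by rewrite -rmorphM ca rmorph1.
exists (b * rho WV c); split=> [|b' tb'].
  by rewrite mresZ scalerA -mulrA ca' mulr1.
rewrite (bu (b' * rho WV a)); last by rewrite tb' mresZ scalerA.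
by rewrite -mulrA [_ * rho WV c]mulrC ca' mulr1.
Qed.

Lemma trivializes_coef_unit L V (e t : L V) (a : \O V) :
  trivializes e -> trivializes t -> t = a *: e -> exists c, c * a = 1.
Proof.
move=> te tt ta; have [c ec] := trivializes_coef e tt; exists c.
by apply: (trivializes_inj te); rewrite scale1r -scalerA -ta.
Qed.

End RestrictionLemmas.

Section Integral.
Variables (Y : scheme) (Yint : integral_scheme Y).
Implicit Types (U V W : opens Y).

Lemma integral_sec U y : oset U y -> integral_domain (\O U).
Proof. by move=> Uy; apply: Yint.2; exists y. Qed.

Lemma domainX (A : comPzRingType) (a : A) n :
  integral_domain A -> a ^+ n = 0 -> a = 0.
Proof.
move=> [A1 AM]; elim: n => [/A1//|n IHn].
by rewrite exprS => /AM[].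
Qed.

(** An empty basic open makes [a] nilpotent, hence zero in a domain. *)
Lemma basic_open_nonempty U D a y : @basic_opens Y U D -> oset U y ->
  a <> 0 -> exists z, oset (D a) z.
Proof.
move=> bD Uy a0; apply: contrapT => nz.
have i0 : is_ideal [set b : \O U | b = 0].
  by split=> [|_ _ -> ->|b _ ->] //=; rewrite ?addr0 ?mulr0.
have [|n] := bo_rad bD (x := a) i0; first by move=> z Dz; case: nz; exists z.
by move=> /(domainX (integral_sec Uy)).
Qed.

(** If [U] and [V] were disjoint, the sections equal to 1 on one and 0 on the other would be two
    nonzero sections on the union with product zero. *)
Lemma opens_meet U V y z : oset U y -> oset V z -> exists w, oset (capO U V) w.
Proof.
move=> Uy Vz; apply: contrapT => nw.
pose G b := if b then U else V.
have GU b : G b `<=` cupO G by move=> x Gx; exists b.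
have empty W (a b : \O W) : W `<=` U -> W `<=` V -> a = b.
  by move=> WU WV; apply: sec_ext => w Ww; case: nw; exists w; split; auto.
have compat (p : bool -> bool) b c W (Wb : W `<=` G b) (Wc : W `<=` G c) :
    rho Wb ((p b)%:R : \O (G b)) = rho Wc ((p c)%:R : \O (G c)).
  by move: b c Wb Wc => [] [] Wb Wc; rewrite ?rmorph_nat //; apply: empty.
have [|s [sP _]] := rs_sheaf GU (s := fun b => b%:R) _ (compat id).
  by [].
have [|t [tP _]] := rs_sheaf GU (s := fun b => (~~ b)%:R) _ (compat negb).
  by [].
have st : s * t = 0.
  apply: sec_ext => w [b _ Gw]; exists (G b), (GU b); split=> //.
  by rewrite rmorphM sP tP rmorph0; case: (b); rewrite ?mulr0 ?mul0r.
have [|_ /(_ s t st)[h|h]] := @integral_sec (cupO G) y; first by exists true.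
  by have := sP true; rewrite h rmorph0; have [+ _] := integral_sec Uy; auto.
by have := tP false; rewrite h rmorph0; have [+ _] := integral_sec Vz; auto.
Qed.

(** Near any point of [U], [s] is a fraction with numerator [x] on a chart. This [x] vanishes on a
    smaller basic open inside [V], so a power of a nonzero function kills it in a domain. *)
Lemma rho_eq0 U V (VU : V `<=` U) z (s : \O U) :
  oset V z -> rho VU s = 0 -> s = 0.
Proof.
move=> Vz s0; apply: sec_ext => y Uy.
have [B [By /affine_basic_opens[D bD]]] := sch_affine y.
have [a [Day DaBU]] := bo_basis bD (V := capO B U) (fun z h => h.1) (conj By Uy).
have DB := bo_sub bD (a := a).
have DU : D a `<=` U by move=> w /DaBU[].
exists (D a), DU; split=> //; rewrite rmorph0.
have [[c ac] _ _] := bo_loc bD DB erefl.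
have [_ /(_ (rho DU s))[n [x ex]] _] := bo_loc bD DB erefl.
have [w [Daw Vw]] := opens_meet Day Vz.
have [a' [Da'w Da'DV]] := bo_basis bD (V := capO (D a) V) (y := w)
  (fun z h => DB z h.1) (conj Daw Vw).
have D'B := bo_sub bD (a := a').
have D'D : D a' `<=` D a by move=> ? /Da'DV[].
have D'V : D a' `<=` V by move=> ? /Da'DV[].
have [_ _ /(_ x)[|k]] := bo_loc bD D'B erefl.
  rewrite -(rho_comp DB D'D D'B) -ex rmorphM (rho_comp _ _ (subset_trans D'D DU)).
  by rewrite -(rho_comp VU D'V) s0 rmorph0 mul0r.
have [_ BM] := integral_sec By; case/BM => [/(domainX (integral_sec By)) a'0|x0].
  have i0 := bo_pt bD (DB _ Daw).
  by have := ideal0 i0; rewrite -a'0 /= => /(_ Da'w).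
suff : rho DU s * (rho DB a ^+ n * c ^+ n) = 0 by rewrite -exprMn ac expr1n mulr1.
by rewrite mulrA ex x0 rmorph0 mul0r.
Qed.

(** Local generators reduce the claim to coefficients, where [rho_eq0] applies. *)
Lemma mres_inj (L : modSheaf Y) U V (VU : V `<=` U) z : invertible L ->
  oset V z -> injective (mres VU : L U -> L V).
Proof.
move=> iL Vz s t est; apply/eqP; rewrite -subr_eq0; apply/eqP.
have : mres VU (s - t) = 0 by rewrite mresB est subrr.
move: (s - t) => {est t}s s0.
apply: msec_ext => y Uy; have [W [Wy [e te]]] := iL y.
have WW : capO W U `<=` W by move=> ? [].
have WU : capO W U `<=` U by move=> ? [].
exists (capO W U), WU; split=> //; rewrite mres0.
have te' := trivializes_res WW te; have [a ea] := trivializes_coef (mres WU s) te'.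
rewrite ea.
have [w [Ww Vw]] := opens_meet (U := capO W U) (conj Wy Uy) Vz.
have W'W : capO (capO W U) V `<=` capO W U by move=> ? [].
have W'V : capO (capO W U) V `<=` V by move=> ? [].
rewrite (_ : a = 0) ?scale0r //; apply: (rho_eq0 (VU := W'W) (conj Ww Vw)).
apply: (trivializes_inj (trivializes_res W'W te')).
rewrite -mresZ -ea scale0r (mres_comp _ _ (subset_trans W'W WU)).
by rewrite -(mres_comp VU W'V) s0 mres0.
Qed.

End Integral.

(** * Graded algebras of sheaves *)

Section GradedAlgebra.
Variables (Y : ringedSpace) (M : zmodType) (L : gradedAlgebra Y M).
Implicit Types (U V W : opens Y) (m n p : M).

Definition gmul U m n p (e : m + n = p) (s : L m U) (t : L n U) : L p U :=
  ga_mul L e U s t.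

Section Mul.
Variable U : opens Y.
Implicit Types (a : \O U).

Lemma gmulE m n p (e e' : m + n = p) (s : L m U) (t : L n U) :
  gmul e s t = gmul e' s t.
Proof. by rewrite (eq_irrelevance e e'). Qed.

Lemma gmulC m n p (e : m + n = p) (e' : n + m = p) (s : L m U) (t : L n U) :
  gmul e s t = gmul e' t s.
Proof. exact: ga_mulC. Qed.

Lemma gmulA m n p mn np q (e1 : m + n = mn) (e2 : mn + p = q)
    (e3 : n + p = np) (e4 : m + np = q)
    (s : L m U) (t : L n U) (u : L p U) :
  gmul e2 (gmul e1 s t) u = gmul e4 s (gmul e3 t u).
Proof. exact: ga_mulA. Qed.

Lemma gmulDl m n p (e : m + n = p) (s s' : L m U) (t : L n U) :
  gmul e (s + s') t = gmul e s t + gmul e s' t.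
Proof.
have := bh_linl (ga_mul L e) t 1 s s'; rewrite !scale1r; exact.
Qed.

Lemma gmul0l m n p (e : m + n = p) (t : L n U) : gmul e (0 : L m U) t = 0.
Proof. by apply: (addrI (gmul e 0 t)); rewrite -gmulDl !addr0. Qed.

Lemma gmulZl m n p (e : m + n = p) a (s : L m U) (t : L n U) :
  gmul e (a *: s) t = a *: gmul e s t.
Proof.
by have := bh_linl (ga_mul L e) t a s 0; rewrite -/(gmul _ _ _) !addr0 => ->;
   rewrite -!/(gmul _ _ _) gmul0l addr0.
Qed.

Lemma gmulZr m n p (e : m + n = p) a (s : L m U) (t : L n U) :
  gmul e s (a *: t) = a *: gmul e s t.
Proof.
have e' : n + m = p by rewrite addrC.
by rewrite (gmulC _ e') gmulZl (gmulC _ e).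
Qed.

Lemma gmul_suml m n p (e : m + n = p) (J : Type) (r : seq J)
    (s : J -> L m U) (t : L n U) :
  gmul e (\sum_(j <- r) s j) t = \sum_(j <- r) gmul e (s j) t.
Proof.
by apply: (big_morph (fun s => gmul e s t)); [move=> *; exact: gmulDl|
   exact: gmul0l].
Qed.

Lemma gmul_sumr m n p (e : m + n = p) (J : Type) (r : seq J)
    (s : L m U) (t : J -> L n U) :
  gmul e s (\sum_(j <- r) t j) = \sum_(j <- r) gmul e s (t j).
Proof.
have e' : n + m = p by rewrite addrC.
by rewrite (gmulC _ e') gmul_suml; apply: eq_bigr => j _; exact: gmulC.
Qed.

Definition gone : L 0 U := ga_unit L U 1.

Lemma gmul1l m (e : 0 + m = m) (t : L m U) : gmul e gone t = t.
Proof. by rewrite /gmul ga_unitP scale1r. Qed.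

(** The degree equation passed to [gmul] places the power in [L (m *+ k)] without a transport along
    equal degrees. *)
Fixpoint gpow m (s : L m U) (k : nat) : L (m *+ k) U :=
  match k return L (m *+ k) U with
  | 0%N => gone
  | k'.+1 => gmul (esym (mulrS m k')) s (gpow s k')
  end.

Lemma gpowD m (s : L m U) j k (e : m *+ j + m *+ k = m *+ (j + k)) :
  gmul e (gpow s j) (gpow s k) = gpow s (j + k).
Proof.
elim: j e => [|j IHj] e /=; first by rewrite -[LHS](gmul1l (add0r _)) gmul1l gmul1l.
by rewrite (gmulA _ _ (esym (mulrnDr _ _ _)) (esym (mulrS _ _))) IHj.
Qed.

Lemma gpowZ m a (s : L m U) k : gpow (a *: s) k = a ^+ k *: gpow s k.
Proof.
elim: k => [|k IHk] /=; first by rewrite expr0 scale1r.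
by rewrite IHk gmulZl gmulZr scalerA exprS.
Qed.

Lemma gmul_unitZ m (e : 0 + m = m) a (t : L m U) :
  gmul e (ga_unit L U a) t = a *: t.
Proof. exact: ga_unitP. Qed.

(** With it a function [a], viewed as a section of degree zero, can take the place of [g] in the
    extension of sections. *)
Lemma gmul_pow_unit m k (e : 0 *+ k + m = m) a (t : L m U) :
  gmul e (gpow (ga_unit L U a) k) t = a ^+ k *: t.
Proof.
elim: k e => [|k IHk] /= e; first by rewrite gmul1l expr0 scale1r.
have e0 : 0 *+ k + m = m by rewrite mul0rn add0r.
by rewrite (gmulA _ _ e0 (add0r m)) IHk gmul_unitZ scalerA exprS.
Qed.

End Mul.

Lemma mres_mul U V (VU : V `<=` U) m n p (e : m + n = p)
    (s : L m U) (t : L n U) :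
  mres VU (gmul e s t) = gmul e (mres VU s) (mres VU t).
Proof. exact/esym/bh_nat. Qed.

Lemma mres_unit U V (VU : V `<=` U) (a : \O U) :
  mres VU (ga_unit L U a) = ga_unit L V (rho VU a).
Proof. exact/esym/(mh_nat (ga_unit L)). Qed.

Lemma mres_pow U V (VU : V `<=` U) m (s : L m U) k :
  mres VU (gpow s k) = gpow (mres VU s) k.
Proof.
elim: k => [|k IHk] /=; first by rewrite mres_unit rmorph1.
by rewrite mres_mul IHk.
Qed.

Lemma trivializes_gone U : trivializes (gone U).
Proof.
have E W (WU : W `<=` U) a : a *: mres WU (gone U) = ga_unit L W a.
  rewrite mres_unit rmorph1 -(gmul_unitZ (addr0 0)).
  by rewrite (gmulC _ (addr0 0)) gmul1l.
move=> W WU t; have [h hK Kh] := ga_unit_iso L W.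
exists (h t); split=> [|a ->]; first by rewrite E Kh.
by rewrite E hK.
Qed.

End GradedAlgebra.

(* The pushforward of the restriction of the structure sheaf to V. *)
Section SectionsOnMeet.
Variables (X : ringedSpace) (V : opens X).
Implicit Types U W : opens X.

Definition meet_sec U : Type := \O (capO U V).

HB.instance Definition _ U := GRing.ComPzRing.on (meet_sec U).

Lemma capO_subl U : capO U V `<=` U.
Proof. by move=> y []. Qed.

Lemma capO_subr U : capO U V `<=` V.
Proof. by move=> y []. Qed.

Lemma capO_sub U W : W `<=` U -> capO W V `<=` capO U V.
Proof. by move=> WU y [/WU Uy Vy]. Qed.

Definition meet_scale U (a : \O U) (s : meet_sec U) : meet_sec U :=
  rho (@capO_subl U) a * s.

Lemma meet_scaleA U a b (s : meet_sec U) :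
  meet_scale a (meet_scale b s) = meet_scale (a * b) s.
Proof. by rewrite /meet_scale rmorphM mulrA. Qed.

Lemma meet_scale1 U : left_id 1 (@meet_scale U).
Proof. by move=> s; rewrite /meet_scale rmorph1 mul1r. Qed.

Lemma meet_scaleDr U : right_distributive (@meet_scale U) +%R.
Proof. by move=> a s t; rewrite /meet_scale mulrDr. Qed.

Lemma meet_scaleDl U (s : meet_sec U) : {morph (@meet_scale U)^~ s : a b / a + b}.
Proof. by move=> a b; rewrite /meet_scale rmorphD mulrDl. Qed.

HB.instance Definition _ U := GRing.Zmodule_isLmodule.Build (\O U) (meet_sec U)
  (@meet_scaleA U) (@meet_scale1 U) (@meet_scaleDr U) (@meet_scaleDl U).

Definition meet_res U W (WU : W `<=` U) (s : meet_sec U) : meet_sec W :=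
  rho (capO_sub WU) s.

Lemma meet_res_lin U W (WU : W `<=` U) (a : \O U) (s t : meet_sec U) :
  meet_res WU (a *: s + t) = rho WU a *: meet_res WU s + meet_res WU t.
Proof.
rewrite /meet_res rmorphD; congr (_ + _); rewrite rmorphM; congr (_ * _).
by rewrite !(rho_comp _ _ (subset_trans (@capO_subl W) WU)).
Qed.

Lemma meet_res_id U (UU : U `<=` U) (s : meet_sec U) : meet_res UU s = s.
Proof. exact: rho_id. Qed.

Lemma meet_res_comp U W W' (WU : W `<=` U) (W'W : W' `<=` W) (W'U : W' `<=` U)
    (s : meet_sec U) :
  meet_res W'W (meet_res WU s) = meet_res W'U s.
Proof. exact: rho_comp. Qed.

Lemma meet_sheaf : is_sheaf meet_res.
Proof.
move=> U J D DU cov s scomp.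
have cov' : capO U V `<=` \bigcup_j capO (D j) V.
  by move=> y [/cov[j _ Dy] Vy]; exists j.
have [|t [tP tu]] := rs_sheaf (fun j => capO_sub (DU j)) cov' (s := s).
  move=> i j W Wi Wj.
  have Wi' : W `<=` D i by move=> y /Wi[].
  have Wj' : W `<=` D j by move=> y /Wj[].
  have WW : W `<=` capO W V by move=> y Wy; split=> //; case: (Wi y Wy).
  have := congr1 (rho WW) (scomp i j W Wi' Wj').
  by rewrite /meet_res !(rho_comp _ _ Wi) !(rho_comp _ _ Wj).
by exists t; split.
Qed.

(** Target of a bilinear map built from coefficients that exist only over [V], against which the
    universal property of the tensor product is tested. *)
Definition meetSheaf : modSheaf X :=
  ModSheaf meet_res_lin meet_res_id meet_res_comp meet_sheaf.

End SectionsOnMeet.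

(** * Products of local generators *)

Section TensorTrivializes.
Variables (X : ringedSpace) (V : opens X).
Variables (L L' N : modSheaf X) (b : biHom L L' N).
Variables (e : L V) (e' : L' V).
Hypotheses (te : trivializes e) (te' : trivializes e') (bT : is_tensor b).
Implicit Types U W : opens X.

Definition coef (K : modSheaf X) (d : K V) (td : trivializes d) U (s : K U) :
    \O (capO U V) :=
  sval (cid (trivializes_coef (mres (@capO_subl X V U) s)
                              (trivializes_res (@capO_subr X V U) td))).

Lemma coefP (K : modSheaf X) (d : K V) (td : trivializes d) U (s : K U) :
  mres (@capO_subl X V U) s = coef td s *: mres (@capO_subr X V U) d.
Proof. by rewrite /coef; case: cid. Qed.

Lemma coef_lin (K : modSheaf X) (d : K V) (td : trivializes d) U a (s t : K U) :
  coef td (a *: s + t) = rho (@capO_subl X V U) a * coef td s + coef td t.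
Proof.
apply: (trivializes_inj (trivializes_res (@capO_subr X V U) td)).
by rewrite -coefP mresD mresZ scalerDl -scalerA -!coefP.
Qed.

Lemma coef_nat (K : modSheaf X) (d : K V) (td : trivializes d) U W
    (WU : W `<=` U) (s : K U) :
  coef td (mres WU s) = rho (@capO_sub X V U W WU) (coef td s).
Proof.
apply: (trivializes_inj (trivializes_res (@capO_subr X V W) td)).
have E := mres_comp (@capO_subr X V U) (capO_sub WU) (@capO_subr X V W) d.
rewrite -coefP -E -mresZ -coefP.
by rewrite !(mres_comp _ _ (subset_trans (@capO_subl X V W) WU)).
Qed.

Definition coef_mul U (s : L U) (t : L' U) : meetSheaf V U :=
  coef te s * coef te' t.

Lemma coef_mul_linl U (t : L' U) : linear (fun s => coef_mul s t).
Proof.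
move=> a s s'; rewrite /coef_mul coef_lin mulrDl -mulrA.
by [].
Qed.

Lemma coef_mul_linr U (s : L U) : linear (fun t => coef_mul s t).
Proof.
by move=> a t t'; rewrite /coef_mul coef_lin mulrDr mulrCA.
Qed.

Lemma coef_mul_nat U W (WU : W `<=` U) (s : L U) (t : L' U) :
  coef_mul (mres WU s) (mres WU t) = mres WU (coef_mul s t).
Proof. by rewrite /coef_mul !coef_nat -rmorphM. Qed.

Lemma coef1 (K : modSheaf X) (d : K V) (td : trivializes d) : coef td d = 1.
Proof.
apply: (trivializes_inj (trivializes_res (@capO_subr X V V) td)).
by rewrite -coefP scale1r; exact: mresE.
Qed.

(* The universal property, applied to the product of the coefficients, makes
   the coefficient of b(e, e') with respect to a local generator of N a unit. *)
Lemma tensor_trivializes W (WV : W `<=` V) (d : N W) : trivializes d ->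
  trivializes (mres WV (b V e e')).
Proof.
move=> td; have [h [hP _]] := bT (BiHom coef_mul_linl coef_mul_linr coef_mul_nat).
have [a ea] := trivializes_coef (mres WV (b V e e')) td.
have := congr1 (h W) ea.
have hZ : h W (a *: d) = a *: h W d.
  have h0 : h W 0 = 0.
    have := mh_lin h (U := W) 1 0 0; rewrite !scale1r addr0 => /esym/(canRL (addrK _)).
    by rewrite subrr.
  by have := mh_lin h (U := W) a d 0; rewrite h0 !addr0.
(* [e] and [e'] have coefficient 1 with respect to themselves, so [h] turns the equation [ea] into:
   [a] times [h d] is 1. *)
rewrite hZ mh_nat hP /= /coef_mul !coef1 mulr1 /meet_res rmorph1.
have WW : W `<=` capO W V by move=> y Wy; split=> //; exact: (WV y Wy).
move=> /(congr1 (rho WW)); rewrite rmorph1 rmorphM.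
rewrite (rho_comp _ _ (@subset_refl _ _)) rho_id => /esym ha.
by rewrite ea; apply: (@trivializes_unit _ _ _ _ _ (rho WW (h W d))) => //; rewrite mulrC.
Qed.

End TensorTrivializes.

(** * Spans of global sections *)

Lemma dep_choice (I : Type) (T : I -> Type) (P : forall i, T i -> Prop) :
  (forall i, exists x, P i x) -> exists f : forall i, T i, forall i, P i (f i).
Proof. by move=> H; exists (fun i => sval (cid (H i))) => i; case: cid. Qed.

(** Coefficients with respect to a generator are unique, so the local ones agree on overlaps and
    glue. *)
Lemma trivializes_local (X : ringedSpace) (L : modSheaf X) (V : opens X)
    (e : L V) :
  (forall y, oset V y -> exists (W : opens X) (WV : W `<=` V),
     oset W y /\ trivializes (mres WV e)) -> trivializes e.
Proof.
move=> eloc W WV t.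
have H (y : {y | oset W y}) : exists D : opens X, [/\ D `<=` W, oset D (sval y) &
    forall DV : D `<=` V, trivializes (mres DV e)].
  case: y => y Wy /=; have [D [DV [Dy te]]] := eloc y (WV _ Wy).
  exists (capO D W); split=> [z []//|//|DWV].
  have DD : capO D W `<=` D by move=> z [].
  by have := trivializes_res DD te; rewrite (mres_comp _ _ DWV).
have [D DP] := choice H.
have DW y : D y `<=` W by have [] := DP y.
have DV y : D y `<=` V := subset_trans (DW y) WV.
have te y : trivializes (mres (DV y) e) by have [_ _] := DP y; exact.
have Dcov : W `<=` \bigcup_y D y.
  by move=> y Wy; exists (exist _ y Wy) => //; have [] := DP (exist _ y Wy).
have [a aP] := dep_choice (fun y => trivializes_coef (mres (DW y) t) (te y)).
have [|c [cP _]] := rs_sheaf DW Dcov (s := a).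
  move=> y z D' D'y D'z.
  apply: (trivializes_inj (trivializes_res D'y (te y))).
  rewrite -mresZ -aP (mres_comp _ _ (subset_trans D'y (DV y))).
  rewrite -(mres_comp (DV z) D'z) -mresZ -aP.
  by rewrite !(mres_comp _ _ (subset_trans D'y (DW y))).
exists c; split=> [|c' tc'].
  apply: msec_ext => y /Dcov[z _ Dy]; exists (D z), (DW z); split=> //.
  by rewrite mresZ cP (mres_comp _ _ (DV z)) aP.
apply: sec_ext => y /Dcov[z _ Dy]; exists (D z), (DW z); split=> //.
apply: (trivializes_inj (te z)).
by rewrite cP -aP tc' mresZ (mres_comp _ _ (DV z)).
Qed.

Lemma zero_ideal_near (X : ringedSpace) (L : modSheaf X) (t : L (opensT X))
    (U : opens X) a y : zero_ideal t U a -> oset U y ->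
  nearby y (fun W => exists (WU : W `<=` U) (e : L W) (b c : \O W),
    [/\ trivializes e, mres (@opens_subT X W) t = b *: e & rho WU a = c * b]).
Proof.
move=> ta Uy; have [V [VU [Vy [e [b [c [te tb ac]]]]]]] := ta y Uy.
exists V; split=> // W WV Wy; exists (subset_trans WV VU).
exists (mres WV e), (rho WV b), (rho WV c); split.
- exact: trivializes_res.
- by rewrite -mresZ -tb (mres_comp _ _ (@opens_subT X W)).
- by rewrite -rmorphM -ac (rho_comp _ _ (subset_trans WV VU)).
Qed.

Section InvertibleGraded.
Variables (Y : scheme) (M : zmodType) (L : gradedAlgebra Y M).
Hypothesis L_inv : forall m, invertible (L m).
Hypothesis L_tensor : forall m n, is_tensor (ga_mul L (erefl (m + n))).
Implicit Types (U V W D B : opens Y) (m n p q : M) (y : Y).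

Lemma trivializes_near y m :
  nearby y (fun W => exists d : L m W, trivializes d).
Proof.
have [V [Vy [d td]]] := L_inv m y; exists V; split=> // W WV Wy.
by exists (mres WV d); exact: trivializes_res.
Qed.

(** Being a generator is a local property, and locally degree [m + n] has some generator with which
    the product can be compared. *)
Lemma trivializes_mul U m n p (E : m + n = p) (s : L m U) (t : L n U) :
  trivializes s -> trivializes t -> trivializes (gmul E s t).
Proof.
case: p / E => ts tt; apply: trivializes_local => y Uy.
have [W [Wy [WU [d td]]]] :=
  nearby_ex (nearby_and (nearby_in Uy) (trivializes_near y (m + n))).
exists W, WU; split=> //.
exact: (tensor_trivializes ts tt (@L_tensor m n) WU td).
Qed.

Lemma trivializes_pow U m (s : L m U) k : trivializes s -> trivializes (gpow s k).
Proof.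
move=> ts; elim: k => [|k IHk] /=; first exact: trivializes_gone.
exact: trivializes_mul.
Qed.

Definition generated_at U m (s : L m U) y :=
  exists V (VU : V `<=` U), oset V y /\ trivializes (mres VU s).

Lemma generated_near U m (s : L m U) y : generated_at s y ->
  nearby y (fun W => exists WU : W `<=` U, trivializes (mres WU s)).
Proof.
move=> [V [VU [Vy ts]]]; exists V; split=> // W WV Wy.
exists (subset_trans WV VU); rewrite -(mres_comp VU WV).
exact: trivializes_res.
Qed.

Section Span.
Variables (k : nat) (dg : 'I_k -> M) (f : forall i, L (dg i) (opensT Y)).
Arguments f : clear implicits.

Lemma dgK p i : p - dg i + dg i = p.
Proof. exact: subrK. Qed.

(** The degree [p] part of the ideal generated by the [f i] in the graded ring of sections over
    [U]. *)
Definition in_span U p (x : L p U) := exists a : forall i, L (p - dg i) U,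
  x = \sum_i gmul (dgK p i) (a i) (mres (@opens_subT Y U) (f i)).

Lemma in_span0 U p : in_span (0 : L p U).
Proof. by exists (fun=> 0); rewrite big1 // => i _; exact: gmul0l. Qed.

Lemma in_spanD U p (x x' : L p U) : in_span x -> in_span x' -> in_span (x + x').
Proof.
move=> [a ->] [b ->]; exists (fun i => a i + b i).
by rewrite -big_split; apply: eq_bigr => i _; rewrite gmulDl.
Qed.

Lemma in_spanZ U p c (x : L p U) : in_span x -> in_span (c *: x).
Proof.
move=> [a ->]; exists (fun i => c *: a i).
by rewrite scaler_sumr; apply: eq_bigr => i _; rewrite gmulZl.
Qed.

Lemma in_span_mul U n p q (E : n + p = q) (g : L n U) (x : L p U) :
  in_span x -> in_span (gmul E g x).
Proof.
have En i : n + (p - dg i) = q - dg i by rewrite addrA E.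
move=> [a ->]; exists (fun i => gmul (En i) g (a i)); rewrite gmul_sumr.
by apply: eq_bigr => i _; rewrite (gmulA (En i) (dgK q i) (dgK p i) E).
Qed.

Lemma in_span_res U V (VU : V `<=` U) p (x : L p U) :
  in_span x -> in_span (mres VU x).
Proof.
move=> [a ->]; exists (fun i => mres VU (a i)); rewrite mres_sum.
by apply: eq_bigr => i _; rewrite mres_mul (mres_comp _ _ (@opens_subT Y V)).
Qed.

(* Local generators of the L (d - dg i) are what turns the local generators
   of the zero ideals of the f i into coefficients of a combination. *)
Lemma in_span_near d (t : L d (opensT Y)) y :
  ideal_le (zero_ideal t) (ideal_sum (fun i => zero_ideal (f i))) ->
  exists W, oset W y /\ in_span (mres (@opens_subT Y W) t).
Proof.
move=> tf; have [V [Vy [ed ted]]] := nearby_ex (trivializes_near y d).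
have [b tb] := trivializes_coef (mres (@opens_subT Y V) t) ted.
(* [b] is a local equation of [t], so the hypothesis writes it near [y] as a sum of multiples of
   local equations of the [f i]. *)
have zb : zero_ideal t V b.
  move=> z Vz; exists V, (@subset_refl _ _); split=> //.
  by exists ed, b, 1; split=> //; rewrite rho_id mul1r.
have [V' [V'V [V'y [u [uf ub]]]]] := tf _ _ zb y Vy.
have [W [Wy [WV' [WP WP']]]] := nearby_ex (nearby_and (nearby_in V'y)
  (nearby_and (nearby_all (fun i => zero_ideal_near (uf i) V'y))
              (nearby_all (fun i => trivializes_near y (d - dg i))))).
have WV := subset_trans WV' V'V.
have H i : exists a : L (d - dg i) W,
    rho WV' (u i) *: mres WV ed =
    gmul (dgK d i) a (mres (@opens_subT Y W) (f i)).
  have [WV'' [ei [bi [ci [tei fi]]]]] := WP i; rewrite (rhoE _ WV') => ui.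
  have [e' te'] := WP' i.
  (* With [f i = bi ei], [u i = ci bi] and [ed = r (e' ei)], the section [u i ed] is [ci r e'] times
     [f i]. *)
  have [r er] := trivializes_coef (mres WV ed) (trivializes_mul (dgK d i) te' tei).
  exists ((ci * r) *: e'); rewrite ui fi er gmulZl gmulZr !scalerA.
  by congr (_ *: _); ring.
have [a aP] := dep_choice H; exists W; split=> //; exists a.
rewrite -(mres_comp (@opens_subT Y V) WV) tb mresZ -(rho_comp V'V WV') ub.
rewrite rmorph_sum scaler_suml.
by apply: eq_bigr => i _; rewrite aP.
Qed.

(** Near [y] the product of [g] with a local generator is a generator. Comparing coefficients in
    [g t] therefore cancels [g] and expresses the local equation of [t] through those of the
    [f i]. *)
Lemma ideal_le_of_span d (t : L d (opensT Y)) :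
  (forall y, exists n p (E : n + d = p) (g : L n (opensT Y)),
     generated_at g y /\ in_span (gmul E g t)) ->
  ideal_le (zero_ideal t) (ideal_sum (fun i => zero_ideal (f i))).
Proof.
move=> tg U r tr y Uy; have [n [p [E [g [gy [a ga]]]]]] := tg y.
have [W [Wy [[WU [ed [b [c [ted tb rb]]]]] [[WT tg'] [WP WP']]]]] :=
  nearby_ex (nearby_and (zero_ideal_near tr Uy) (nearby_and (generated_near gy)
  (nearby_and (nearby_all (fun i => trivializes_near y (dg i)))
              (nearby_all (fun i => trivializes_near y (p - dg i)))))).
have te := trivializes_mul E tg' ted.
have H i : exists x : \O W * \O W, exists2 ei : L (dg i) W, trivializes ei &
    mres (@opens_subT Y W) (f i) = x.2 *: ei /\
    gmul (dgK p i) (mres WT (a i)) (mres WT (f i)) = (x.1 * x.2) *: gmul E (mres WT g) ed.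
  have [[ei tei] [ei' tei']] := (WP i, WP' i).
  have [bi fi] := trivializes_coef (mres WT (f i)) tei.
  have [xi ai] := trivializes_coef (mres WT (a i)) tei'.
  have [yi ei'i] := trivializes_coef (gmul (dgK p i) ei' ei) te.
  exists (xi * yi, bi), ei => //=; split; first by rewrite -fi; exact: mresE.
  by rewrite fi ai gmulZl gmulZr ei'i !scalerA; congr (_ *: _); ring.
have [x xP] := choice H.
exists W, WU; split=> //; exists (fun i => (c * (x i).1) * (x i).2); split.
  move=> i z Wz; exists W, (@subset_refl _ _); split=> //.
  have [ei tei [fi _]] := xP i; exists ei, (x i).2, (c * (x i).1).
  by split=> //; rewrite rho_id.
rewrite rb; under eq_bigr do rewrite -mulrA.
rewrite -mulr_sumr; congr (_ * _); apply: (trivializes_inj te).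
rewrite -gmulZr -tb (mresE _ WT) -mres_mul ga mres_sum scaler_suml.
apply: eq_bigr => i _; have [_ _ [_ <-]] := xP i.
by rewrite mres_mul (mres_comp _ _ WT).
Qed.

End Span.
End InvertibleGraded.

(** * Extension of sections *)

Section Extension.
Variables (Y : scheme) (Yint : integral_scheme Y).
Implicit Types (U V W D B : opens Y) (y : Y).

Lemma basic_open_unit U (D : \O U -> opens Y) (bD : basic_opens D) b (DU : D b `<=` U) :
  exists c, rho DU b * c = 1.
Proof. by have [] := bo_loc bD DU erefl. Qed.

(** On a small basic open of some [b] around [y], the inverse of [a] has a power of [b] as
    denominator; so if [a] vanished at [y], a power of [b] would too. *)
Lemma basic_open_of_unit U (D : \O U -> opens Y) (bD : basic_opens D)
    a V (VU : V `<=` U) y c :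
  oset V y -> rho VU a * c = 1 -> oset (D a) y.
Proof.
move=> Vy ac; have [b [Dby bV]] := bo_basis bD VU Vy.
have DU := bo_sub bD (a := b); have iy := bo_pt bD (VU y Vy).
have [_ /(_ (rho bV c))[n [z ez]] ker] := bo_loc bD DU erefl.
have [|r er] := ker (a * z - b ^+ n).
  rewrite rmorphB rmorphM -ez mulrA -(rho_comp VU bV DU a) -rmorphM ac.
  by rewrite rmorph1 mul1r rmorphXn subrr.
apply: contrapT => nDa.
have : [set a | ~ oset (D a) y] (b ^+ (r + n)).
  have -> : b ^+ (r + n) = (b ^+ r * z) * a.
    apply/eqP; rewrite eq_sym -subr_eq0; apply/eqP; rewrite -er exprD; ring.
  exact: (idealM iy).
have Dn k : oset (D (b ^+ k)) y.
  elim: k => [|k IHk]; first by exact: (bo_1 bD (VU y Vy)).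
  by rewrite exprS; apply/(bo_mul bD).
exact.
Qed.

(** Clearing the denominator of [h] gives [z]; the extra factor [b] in [x = b z] keeps [D x] inside
    [D b], whence the exponent [n.+1]. *)
Lemma chart_numerator B (D : \O B -> opens Y) (bD : basic_opens D) b (DB : D b `<=` B)
    (h : \O (D b)) :
  exists x k (xb : D x `<=` D b), rho DB x = h * rho DB b ^+ k /\
    exists c, rho xb h * c = 1.
Proof.
have [_ /(_ h)[n [z ez]] _] := bo_loc bD DB erefl.
have xb : D (b * z) `<=` D b by move=> y /(bo_mul bD)[].
exists (b * z), n.+1, xb.
have e : rho DB (b * z) = h * rho DB b ^+ n.+1 by rewrite rmorphM -ez exprS; ring.
split=> //; have [c xc] := basic_open_unit bD (bo_sub bD (a := b * z)).
exists (rho xb (rho DB b ^+ n.+1) * c).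
rewrite mulrA -rmorphM -e (rho_comp _ _ (bo_sub bD (a := b * z))).
exact: xc.
Qed.

Section Sections.
Variables (L : modSheaf Y) (L_inv : invertible L).

(** Neither [V] nor [D] has to contain the other, so [D] may be a chart that meets [V] only in
    part. *)
Definition extends V (s : L V) D := exists t : L D,
  forall D' (D'D : D' `<=` D) (D'V : D' `<=` V), mres D'D t = mres D'V s.

(** Restriction to a nonempty open set is injective, so agreement on [W] spreads to every common
    open subset. *)
Lemma mres_agree U V W z (WU : W `<=` U) (WV : W `<=` V) (s : L U) (t : L V) :
  oset W z -> mres WU s = mres WV t ->
  forall D (DU : D `<=` U) (DV : D `<=` V), mres DU s = mres DV t.
Proof.
move=> Wz est D DU DV; apply: msec_ext => y Dy.
have [w Cw] := opens_meet Yint Dy Wz.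
have CD : capO D W `<=` D by move=> ? [].
have CW : capO D W `<=` W by move=> ? [].
exists D, (@subset_refl _ _); split=> //; rewrite !mres_id.
apply: (mres_inj (VU := CD) Yint L_inv Cw).
rewrite (mres_comp _ _ (subset_trans CW WU)) (mres_comp _ _ (subset_trans CW WV)).
by rewrite -(mres_comp WU CW) est (mres_comp _ _ (subset_trans CW WV)).
Qed.

(** A nonempty overlap of two pieces meets [V], where both extensions equal [s]; so they agree and
    glue. *)
Lemma extends_glue V W z (s : L V) (J : Type) (D : J -> opens Y) :
  oset V z -> V `<=` W -> (forall j, D j `<=` W) -> W `<=` \bigcup_j D j ->
  (forall j, extends s (D j)) -> extends s W.
Proof.
move=> Vz VW DW cov /dep_choice[t tP].
have [|r [rP _]] := ms_sheaf DW cov (s := t).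
  move=> i j C Ci Cj; apply: msec_ext => y Cy.
  have [w Bw] := opens_meet Yint Cy Vz.
  have BC : capO C V `<=` C by move=> ? [].
  have BV : capO C V `<=` V by move=> ? [].
  exists C, (@subset_refl _ _); split=> //; rewrite !mres_id.
  apply: (mres_inj (VU := BC) Yint L_inv Bw).
  rewrite (mres_comp _ _ (subset_trans BC Ci)) (mres_comp _ _ (subset_trans BC Cj)).
  by rewrite (tP i _ _ BV) (tP j _ _ BV).
exists r; have [j _ Dz] := cov z (VW z Vz).
have Cj : capO (D j) V `<=` D j by move=> ? [].
have CV : capO (D j) V `<=` V by move=> ? [].
apply: (mres_agree (WU := subset_trans Cj (DW j)) (WV := CV) (conj Dz Vz)).
by rewrite -(mres_comp (DW j) Cj) rP tP.
Qed.

End Sections.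

Section Graded.
Variables (M : zmodType) (L : gradedAlgebra Y M).
Hypothesis L_inv : forall m, invertible (L m).
Implicit Types (m n p q : M).

(** On a chart with [g = h e0], the coefficient of [s] over a basic open inside [V] has a power of a
    numerator of [h] as denominator, and a power of [g] clears it. *)
Lemma generated_meets W V n p (g : L n W) (s : L p V) (VW : V `<=` W) y :
  g <> 0 -> (forall z, oset W z -> generated_at g z -> oset V z) ->
  oset W y ->
  exists D, [/\ oset D y, D `<=` W, exists z, oset V z & exists k,
    extends (gmul erefl (gpow (mres VW g) k) s) D].
Proof.
move=> g0 gV Wy.
have [W' [W'y [W'W [[e0' te0'] [ep' tep']]]]] := nearby_ex (nearby_and
  (nearby_in Wy) (nearby_and (trivializes_near L_inv y n) (trivializes_near L_inv y p))).
have [B [By /affine_basic_opens[D bD]]] := sch_affine y.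
have [b [Dby DbBW]] :=
  bo_basis bD (V := capO B W') (fun z h => h.1) (conj By W'y).
have DB := bo_sub bD (a := b).
have DW' : D b `<=` W' by move=> ? /DbBW[].
have DW := subset_trans DW' W'W.
have [e0 te0] : exists e0 : L n (D b), trivializes e0.
  by exists (mres DW' e0'); exact: trivializes_res.
have [ep tep] : exists ep : L p (D b), trivializes ep.
  by exists (mres DW' ep'); exact: trivializes_res.
have [h gh] := trivializes_coef (mres DW g) te0.
have [x [k [xb [ex [hi hhi]]]]] := chart_numerator bD DB h.
have gx : mres (subset_trans xb DW) g = rho xb h *: mres xb e0.
  by rewrite -(mres_comp DW xb) gh mresZ.
(* [h] is invertible on [D x], so [g] is a generator there and [gV] applies. *)
have xV : D x `<=` V.
  move=> z Dz; apply: gV; first exact: DW (xb z Dz).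
  exists (D x), (subset_trans xb DW); split=> //; rewrite gx.
  apply: (trivializes_unit (c := hi)); first by rewrite mulrC.
  exact: trivializes_res.
have [β bβ] := basic_open_unit bD DB.
(* If [x] were zero, [g] would vanish on the nonempty set [D b], hence everywhere. *)
have [w Dw] : exists w, oset (D x) w.
  apply: (basic_open_nonempty Yint bD By) => x0; apply: g0.
  apply: (mres_inj (VU := DW) Yint (L_inv n) Dby).
  rewrite gh mres0.
  suff -> : h = 0 by rewrite scale0r.
  have -> : h = (h * rho DB b ^+ k) * β ^+ k.
    by rewrite -mulrA -exprMn bβ expr1n mulr1.
  by rewrite -ex x0 rmorph0 mul0r.
have [a sa] := trivializes_coef (mres xV s) (trivializes_res xb tep).
have xB := subset_trans xb DB.
have [_ /(_ a)[N [z ez]] _] := bo_loc bD xB erefl.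
exists (D b); split=> //; first by exists w; exact: (xV w Dw).
(* Since [z = a x^N] and [x = h b^k], the coefficient [h^N a] equals [z β^(k N)], which is defined
   on all of [D b]. *)
exists N, ((rho DB z * β ^+ (k * N)) *: gmul erefl (gpow e0 N) ep).
apply: (mres_agree (L_inv _) (WU := xb) (WV := xV) Dw).
rewrite mresZ !mres_mul !mres_pow sa (mres_comp _ _ (subset_trans xb DW)) gx.
rewrite gpowZ gmulZl gmulZr scalerA; congr (_ *: _).
rewrite rmorphM (rho_comp _ _ xB) -ez -(rho_comp DB xb) ex.
rewrite rmorphXn rmorphM rmorphXn exprMn -exprM -mulrA -mulrA -exprMn -rmorphM bβ.
by rewrite rmorph1 expr1n mulr1 mulrC.
Qed.
End Graded.
End Extension.

(** * Extension of linear combinations *)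

Section SpanExtension.
Variables (Y : scheme) (Yint : integral_scheme Y).
Variables (M : zmodType) (L : gradedAlgebra Y M).
Hypothesis L_inv : forall m, invertible (L m).
Implicit Types (U V W : opens Y) (y : Y) (m n p q : M).

Lemma extends_pow V W n p (g : L n W) (s : L p V) (VW : V `<=` W) k K
    (C : opens Y) (CW : C `<=` W) : (k <= K)%N ->
  extends (gmul erefl (gpow (mres VW g) k) s) C ->
  extends (gmul erefl (gpow (mres VW g) K) s) C.
Proof.
move=> /subnK <-; move: (K - k)%N => j [t tP].
have E : n *+ j + (n *+ k + p) = n *+ (j + k) + p by rewrite addrA mulrnDr.
exists (gmul E (gpow (mres CW g) j) t) => C' C'C C'V.
have e : n *+ j + n *+ k = n *+ (j + k) by rewrite mulrnDr.
rewrite (mres_mul C'C) (tP _ _ C'V) !mres_mul !mres_pow -(gpowD _ e).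
by rewrite (gmulA _ _ erefl E) !(mres_comp _ _ (subset_trans C'C CW)).
Qed.

(** Finitely many charts suffice, so a maximum of exponents works. Covering all larger exponents
    lets several sections share one later. *)
Lemma extends_qcompact V W n p (g : L n W) (s : L p V) (VW : V `<=` W) y :
  qcompact W -> oset W y -> g <> 0 ->
  (forall z, oset W z -> generated_at g z -> oset V z) ->
  exists K, forall k, (K <= k)%N ->
    extends (gmul erefl (gpow (mres VW g) k) s) W.
Proof.
move=> qW Wy g0 gV.
have H z : oset W z -> _ := @generated_meets _ Yint _ _ L_inv _ _ _ _ g s VW z g0 gV.
have [z Vz] : exists z, oset V z by have [D []] := H _ Wy.
have [z' /H[D [Dz DW _ [k kP]]]|J [D [DP cov]]] :=
    qW (fun C => exists k, extends (gmul erefl (gpow (mres VW g) k) s) C).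
  by exists D; split=> //; exists k.
have [K KP] := choice (fun j => (DP j).1).
exists (\max_j K j) => k kK.
apply: (extends_glue Yint (L_inv _) Vz VW (fun j => (DP j).2) cov) => j.
apply: extends_pow (DP j).2 _ (KP j).
by apply: leq_trans kK; exact: leq_bigmax.
Qed.

Section Span.
Variables (r : nat) (dg : 'I_r -> M) (f : forall i, L (dg i) (opensT Y)).
Arguments f : clear implicits.
Local Notation in_span := (in_span f).

Lemma span_extend V W n p (g : L n W) (x : L p W) (VW : V `<=` W) y :
  qcompact W -> oset W y -> g <> 0 ->
  (forall z, oset W z -> generated_at g z -> oset V z) ->
  in_span (mres VW x) ->
  exists k, in_span (gmul erefl (gpow g k) x).
Proof.
move=> qW Wy g0 gV [a xa].
have [D [_ _ [z Vz] _]] := generated_meets Yint L_inv (mres VW x) VW g0 gV Wy.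
have [K KP] := choice (fun i => extends_qcompact (a i) VW qW Wy g0 gV).
pose k := (\max_i K i)%N; exists k.
have [t tP] := dep_choice (fun i => KP i k (leq_bigmax i)).
have E i : 0 + (n *+ k + (p - dg i)) = n *+ k + p - dg i by rewrite add0r addrA.
(* Multiplication by the unit section moves [t i] to the degree that [in_span] prescribes for a
   coefficient. *)
exists (fun i => gmul (E i) (gone L W) (t i)).
apply: (mres_inj (VU := VW) Yint (L_inv _) Vz).
rewrite mres_mul mres_pow xa gmul_sumr mres_sum; apply: eq_bigr => i _.
have ti := tP i _ VW (@subset_refl _ _); rewrite mres_id in ti.
have E1 : n *+ k + (p - dg i) + dg i = n *+ k + p by rewrite -addrA subrK.
rewrite !mres_mul ti (mres_comp _ _ (@opens_subT Y V)).
rewrite mres_unit rmorph1 -/(gone L V) (gmulA _ _ E1 (add0r _)) gmul1l.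
by rewrite (gmulA _ _ (dgK _ _ _) erefl).
Qed.

(** This is [span_extend] with the function [a] as a section of degree zero; it can generate only at
    points of [D a]. *)
Lemma span_extend_scalar U p (x : L p U) (D : \O U -> opens Y)
    (bD : basic_opens D) a (DU : D a `<=` U) :
  qcompact U -> in_span (mres DU x) -> exists k, in_span (a ^+ k *: x).
Proof.
move=> qU xa.
(* [span_extend] asks for a nonzero [g] and a point of [U]; in the remaining cases the section is
   zero. *)
have [->|a0] := pselect (a = 0).
  by exists 1%N; rewrite scale0r; exact: in_span0.
have [[y Uy]|U0] := pselect (exists y, oset U y); last first.
  exists 0%N; rewrite (_ : _ *: _ = 0); first exact: in_span0.
  by apply: msec_ext => y Uy; case: U0; exists y.
have unitE : ga_unit L U a = a *: gone L U.
  rewrite -(gmul_unitZ (add0r 0)) (gmulC _ (add0r 0)).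
  by rewrite gmul1l.
have [g0|z Uz [V [VU [Vz tV]]]|k] :=
    @span_extend _ _ 0 p (ga_unit L U a) x DU y qU Uy _ _ xa.
- apply: a0. apply: (trivializes_inj (@trivializes_gone _ _ L U)).
  by rewrite -unitE g0 scale0r.
- have tg := trivializes_res VU (@trivializes_gone _ _ L U).
  have [|c ca] := trivializes_coef_unit tg tV (a := rho VU a).
    by rewrite unitE mresZ.
  by apply: (basic_open_of_unit bD (VU := VU) Vz (c := c)); rewrite mulrC.
(* Multiplication by [gone] brings the degree [0 *+ k + p] back to [p]. *)
move=> xk; exists k.
have E0 : 0 + (0 *+ k + p) = p by rewrite mul0rn !add0r.
have E1 : 0 *+ k + p = p by rewrite mul0rn add0r.
have E2 : 0 + (0 : M) *+ k = 0 *+ k by rewrite add0r.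
rewrite -(gmul_pow_unit E1) -[gpow _ k](gmul1l E2) (gmulA _ _ erefl E0).
exact: in_span_mul.
Qed.

(** The functions that carry [t] into the span form an ideal, which contains for each point of [U] a
    function not vanishing there, hence contains 1. *)
Lemma span_affine U p (t : L p (opensT Y)) : affine U ->
  (forall y, exists W, oset W y /\ in_span (mres (@opens_subT Y W) t)) ->
  in_span (mres (@opens_subT Y U) t).
Proof.
move=> aU tloc; have [D bD] := affine_basic_opens aU.
set tU := mres _ t.
have iI : is_ideal [set a | in_span (a *: tU)].
  split=> /= [|a b|a b].
  - by rewrite scale0r; exact: in_span0.
  - by rewrite scalerDl; exact: in_spanD.
  - by rewrite -scalerA; exact: in_spanZ.
suff : [set a | in_span (a *: tU)] 1 by rewrite /= scale1r.
apply: (basic_opens_cover bD iI) => y Uy; have [W [Wy tW]] := tloc y.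
have [a [Day DaUW]] :=
  bo_basis bD (V := capO U W) (fun z h => h.1) (conj Uy Wy).
have DW : D a `<=` W by move=> ? /DaUW[].
have [|k ak] := @span_extend_scalar U p tU D bD a (bo_sub bD (a := a))
  (affine_qcompact aU).
  rewrite (mres_comp _ _ (@opens_subT Y (D a))) -(mres_comp (@opens_subT Y W) DW).
  exact: in_span_res.
exists (a ^+ k); split=> //; elim: (k) => [|l IHl]; first exact: (bo_1 bD Uy).
by rewrite exprS; apply/(bo_mul bD).
Qed.

Lemma span_of_local U n p (g : L n (opensT Y)) (t : L p (opensT Y)) :
  qcompact (opensT Y) -> affine U -> g <> 0 ->
  (forall y, generated_at g y -> oset U y) ->
  (forall y, exists W, oset W y /\ in_span (mres (@opens_subT Y W) t)) ->
  exists k, in_span (gmul erefl (gpow g k) t).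
Proof.
move=> qY aU g0 gU tloc; have [y _] := Yint.1.
apply: (span_extend (VW := @opens_subT Y U) (y := y)) => //.
  by move=> z _; exact: gU.
exact: span_affine.
Qed.

End Span.
End SpanExtension.

(** * Cox rings *)

Section CoxRing.
Variables (k : fieldType) (Y : schemeOver k) (M : picSubgroup Y).
Variable R : coxRing M.
Implicit Types (m n p d : M) (r : R).
Local Notation Γ m := (cox_sheaf R m (opensT Y)).

(* The range of summation is only bounded below, so that two decompositions
   can be compared over a common range. *)
Definition decomposes r (s : forall m, Γ m) := exists D : seq M,
  (forall m, m \notin D -> s m = 0) /\
  forall D', uniq D' -> {subset D <= D'} -> r = \sum_(m <- D') cox_in R m (s m).

Lemma decomposes_exists r : exists s, decomposes r s.
Proof.
have [D [s ->]] := cox_gen r.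
(* [cox_gen] may list a degree several times, so each component is taken with its multiplicity. *)
exists (fun m => s m *+ count_mem m D), D; split=> [m mD|D' D'uniq DD'].
  by rewrite (count_memPn mD).
rewrite [RHS](bigID (mem D)) /= [X in _ = _ + X]big1 ?addr0; last first.
  by move=> m mD; rewrite (count_memPn mD) raddf0.
rewrite -[RHS]big_filter.
have /(perm_big _)-> : perm_eq [seq m <- D' | m \in D] (undup D).
  apply: uniq_perm; rewrite ?filter_uniq ?undup_uniq // => m.
  by rewrite mem_filter mem_undup andb_idr // => /DD'.
rewrite -big_undup_iterop_count; apply: eq_bigr => m _.
by rewrite raddfMn.
Qed.

Lemma decomposesD r r' s s' : decomposes r s -> decomposes r' s' ->
  decomposes (r + r') (fun m => s m + s' m).
Proof.
move=> [D [s0 sD]] [D' [s'0 sD']]; exists (D ++ D'); split=> [m|E uE DE].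
  by rewrite mem_cat negb_or => /andP[/s0-> /s'0->]; rewrite addr0.
rewrite (sD E) // 1?(sD' E) // -?big_split /=.
- by apply: eq_bigr => m _; rewrite raddfD.
- by move=> m mD; apply: DE; rewrite mem_cat mD orbT.
- by move=> m mD; apply: DE; rewrite mem_cat mD.
Qed.

Lemma decomposes0 : decomposes 0 (fun=> 0).
Proof. by exists [::]; split=> // D' _ _; rewrite big1 // => m _; rewrite raddf0. Qed.

Lemma decomposes_sum (n : nat) (r : 'I_n -> R) (s : 'I_n -> forall m, Γ m) :
  (forall i, decomposes (r i) (s i)) ->
  decomposes (\sum_i r i) (fun m => \sum_i s i m).
Proof.
move=> rs; elim: (index_enum _) => [|i e IHe].
  rewrite big_nil (_ : (fun m => _) = fun=> 0); first exact: decomposes0.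
  by apply: functional_extensionality_dep => m; rewrite big_nil.
rewrite big_cons (_ : (fun m => _) = fun m => s i m + \sum_(j <- e) s j m).
  exact: decomposesD.
by apply: functional_extensionality_dep => m; rewrite big_cons.
Qed.

Lemma decomposes_uniq r s s' : decomposes r s -> decomposes r s' ->
  forall m, s m = s' m.
Proof.
move=> [D [s0 sD]] [D' [s'0 sD']] m.
have [/[!mem_undup] mDD'|] := boolP (m \in undup (D ++ D')); last first.
  by rewrite mem_undup mem_cat negb_or => /andP[/s0-> /s'0->].
apply/eqP; rewrite -subr_eq0; apply/eqP.
apply: (@cox_free _ _ _ R (undup (D ++ D')) (fun m => s m - s' m));
  rewrite ?undup_uniq ?mem_undup //.
under eq_bigr do rewrite raddfB.
rewrite sumrB -sD -?sD' ?subrr ?undup_uniq // => p pD.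
  by rewrite mem_undup mem_cat pD orbT.
by rewrite mem_undup mem_cat pD.
Qed.

Lemma decomposesM r s d (t : Γ d) : decomposes r s ->
  decomposes (r * cox_in R d t) (fun p => gmul (subrK d p) (s (p - d)) t).
Proof.
move=> [D [s0 sD]]; exists (map (+%R^~ d) D); split=> [p pD|E uE DE].
  rewrite s0 ?gmul0l //; apply: contra pD => pD.
  by apply/mapP; exists (p - d); rewrite ?subrK.
under eq_bigr do rewrite cox_inM.
rewrite -mulr_suml; congr (_ * _).
rewrite -(big_map (fun p => p - d) xpredT (fun p => cox_in R p (s p))).
apply: sD; first by rewrite map_inj_uniq //; exact: addIr.
move=> m mD; apply/mapP; exists (m + d); last by rewrite addrK.
by apply: DE; apply/mapP; exists m.
Qed.

Lemma decomposes_in m (t : Γ m) :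
  decomposes (cox_in R m t) (@eqtype.dfwith M (fun m => Γ m) (fun=> 0) m t).
Proof.
exists [:: m]; split=> [p|D uD mD].
  by rewrite inE eq_sym => mp; rewrite dfwith_out.
have mD' : m \in D by rewrite mD // inE.
rewrite (bigD1_seq m) //= dfwith_in big1 ?addr0 // => p.
by rewrite eq_sym => mp; rewrite dfwith_out // raddf0.
Qed.

Lemma cox_in_inj m (t t' : Γ m) : cox_in R m t = cox_in R m t' -> t = t'.
Proof.
move=> e; have := decomposes_in t'; rewrite -e => h.
by have := decomposes_uniq (decomposes_in t) h m; rewrite !dfwith_in.
Qed.

Lemma cox_in_degree m m' (t : Γ m) (t' : Γ m') :
  cox_in R m t = cox_in R m' t' -> cox_in R m t != 0 -> m = m'.
Proof.
move=> e nz; have [//|mm'] := eqVneq m' m.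
have := decomposes_in t'; rewrite -e => h.
have := decomposes_uniq (decomposes_in t) h m; rewrite dfwith_in dfwith_out //.
by move=> t0; rewrite t0 raddf0 eqxx in nz.
Qed.

(** Trades the index [p - d] that [decomposesM] produces for an [m] equal to it only
    propositionally. *)
Lemma gmul_subst m d p (E : m + d = p) (s : forall m, Γ m) (t : Γ d) :
  gmul (subrK d p) (s (p - d)) t = gmul E (s m) t.
Proof.
have e : m = p - d by rewrite -E addrK.
by move: E; rewrite e => E; exact: gmulE.
Qed.

Lemma cox_in_pow n (g : Γ n) N :
  cox_in R (n *+ N) (gpow g N) = cox_in R n g ^+ N.
Proof.
elim: N => [|N IHN] /=; first by rewrite expr0 -[RHS](@cox_in1 _ _ _ R).
by rewrite cox_inM IHN exprS.
Qed.

(** A nonzero homogeneous element determines its degree and its section, so the existential in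
    [div_ideal] has only one candidate. *)
Lemma div_idealE d (t : Γ d) : cox_in R d t != 0 ->
  div_ideal (cox_in R d t) = zero_ideal t.
Proof.
move=> nz; apply: functional_extensionality_dep => U.
apply/seteqP; split=> a; last by exists d, t.
move=> [d' [t' [e]]]; have dd' := cox_in_degree e nz.
by case: d' / dd' t' e => t' /cox_in_inj <-.
Qed.

(** The function 1 lies in the zero ideal near [y] exactly when the local equation of [g] is a unit
    there. *)
Lemma supp_generated n (g : Γ n) y : cox_in R n g != 0 ->
  (~` ideal_supp (div_ideal (cox_in R n g))) y <-> generated_at g y.
Proof.
move=> nz; rewrite div_idealE //; split=> [/contrapT[U [Uy g1]]|[V [VU [Vy tg]]]].
  have [V [VU [Vy [e [b [c [te gb]]]]]]] := g1 y Uy.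
  rewrite rmorph1 => cb; exists V, (@opens_subT Y V); split=> //.
  by rewrite gb; apply: (trivializes_unit (c := c)).
apply; exists V; split=> // z Vz; exists V, (@subset_refl _ _); split=> //.
exists (mres VU g), 1, 1; rewrite scale1r mulr1 rmorph1; split=> //.
exact: mresE.
Qed.

Section Generators.
Variables (s : nat) (dg : 'I_s -> M) (f : forall i, Γ (dg i)).
Let F i := cox_in R (dg i) (f i).

Lemma in_span_ideal p (x : Γ p) : in_span f x -> ideal_gen (range F) (cox_in R p x).
Proof.
move=> [a ->]; rewrite raddf_sum.
rewrite (_ : \sum_i _ = \sum_i cox_in R _ (a i) * F i); first exact: sum_ideal_gen.
apply: eq_bigr => i _; rewrite cox_inM; congr (_ * cox_in R _ _).
exact: mres_id.
Qed.

(** Taking components of the coefficients in the matching degrees makes an arbitrary combination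
    homogeneous. *)
Lemma ideal_in_span p r t : ideal_gen (range F) r -> decomposes r t ->
  in_span f (t p).
Proof.
move=> /ideal_gen_range[a ->] rt.
have [u uP] := choice (fun i => decomposes_exists (a i)).
have := decomposes_sum (fun i => decomposesM (f i) (uP i)).
move=> /(decomposes_uniq rt) ->.
exists (fun i => u i (p - dg i)); apply: eq_bigr => i _.
by rewrite mres_id; exact: gmulE.
Qed.

End Generators.

Lemma psi_saturation (Yint : integral_scheme Y) (Y_qc : qcompact (opensT Y))
    (m s : nat) (g : 'I_m -> R) (f : 'I_s -> R) (I : ideal_family Y) :
  (forall j, homogeneous (g j)) -> (forall j, g j != 0) ->
  refines_affine_covering g ->
  (forall j, homogeneous (f j)) -> (forall j, f j != 0) ->
  (forall U, I U = ideal_sum (fun j => div_ideal (f j)) U) ->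
  psi R I = saturation (ideal_gen (range f)) (ideal_gen (range g)).
Proof.
move=> /dep_choice[dg' /dep_choice[g' gE]] g0 [gcov [C [C_aff _ gC]]].
move=> /dep_choice[dg /dep_choice[f' fE]] f0 IE.
have {IE} IE U : I U = ideal_sum (fun i => zero_ideal (f' i)) U.
  rewrite IE; congr (ideal_sum _ U); apply: functional_extensionality_dep => i.
  by rewrite fE div_idealE // -fE.
have L_inv := @cox_inv _ _ _ R; have L_tensor := @cox_tensor _ _ _ R.
have iF := ideal_genP (range f).
have fF : f = fun i => cox_in R (dg i) (f' i) by apply: funext.
have g_gen j y : (~` ideal_supp (div_ideal (g j))) y <-> generated_at (g' j) y.
  by rewrite gE; apply: supp_generated; rewrite -gE.
apply/seteqP; split.
  apply: ideal_gen_min; first exact: saturation_ideal.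
  move=> _ [[d [t ->]] t0]; rewrite div_idealE // => tI.
  have tloc y : exists W, oset W y /\ in_span f' (mres (@opens_subT Y W) t).
    apply: (in_span_near L_inv L_tensor) => U a /tI.
    by rewrite IE.
  have H j : exists K, ideal_gen (range f) (g j ^+ K * cox_in R d t).
    have [U [/C_aff aU gU]] := gC j.
    have [|y gy|K tK] := span_of_local Yint L_inv (g := g' j) Y_qc aU _ _ tloc.
    - by move=> g'0; have := g0 j; rewrite gE g'0 raddf0 eqxx.
    - by apply: gU; apply/g_gen.
    exists K; have := in_span_ideal tK.
    by rewrite cox_inM cox_in_pow -gE -fF.
  have [K KP] := choice H.
  (* The multipliers of [t] into the ideal of the [f i] form an ideal containing a common power of
     all the [g j], hence a power of the ideal they generate. *)
  have [||N NP] := @ideal_pow_sub _ _ g [set x | ideal_gen (range f) (x * cox_in R d t)]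
      (\max_j K j).
  - split=> /= [|x x' Ix Ix'|a x Ix]; first by rewrite mul0r; exact: ideal0.
      by rewrite mulrDl; exact: idealD.
    by rewrite -mulrA; exact: idealM.
  - move=> j /=; rewrite -(subnK (leq_bigmax j)) exprD -mulrA.
    exact: idealM.
  by exists N => h /NP; rewrite mulrC.
(* Conversely, each nonzero homogeneous component of [r] is shown to be one of the generators of
   [psi]. *)
move=> r [N rN]; have [t tP] := decomposes_exists r.
have [D [_ /(_ (undup D) (undup_uniq D))->]] := tP; last by move=> p; rewrite mem_undup.
apply: ideal_sumr => [|d]; first exact: ideal_genP.
have [->|t0] := eqVneq (cox_in R d (t d)) 0; first exact: (ideal0 (ideal_genP _)).
apply: sub_ideal_gen; split=> //; first by exists d, (t d).
rewrite div_idealE // => U a ta; rewrite IE; move: U a ta.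
apply: (ideal_le_of_span L_inv L_tensor) => y.
have [j /g_gen [V [VU [Vy tg]]]] := gcov y.
(* Some [g j] generates its sheaf at [y], and so does its power in degree [N] times that of
   [g j]. *)
exists (dg' j *+ N), (d + dg' j *+ N), (addrC _ _), (gpow (g' j) N); split.
  exists V, VU; split=> //; rewrite mres_pow.
  exact: trivializes_pow.
rewrite (gmulC _ erefl) -(gmul_subst erefl).
(* The component of [r g_j^N] in this degree is the product of the degree [d] component of [r] with
   [g_j^N]. *)
have := rN _ (gen_ideal_pow g j N); rewrite gE -cox_in_pow fF.
by move=> /(ideal_in_span (d + dg' j *+ N)) /(_ (decomposesM _ tP)).
Qed.

End CoxRing.

(** * Strict complete intersections and saturation *)

Lemma variety_qcompact (k : fieldType) (Y : schemeOver k) :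
  variety Y -> qcompact (opensT Y).
Proof.
move=> [_ [n [U [Ucov Uaff]]]]; apply: (qcompact_cover _ Ucov) => j.
by apply: affine_qcompact; case: (Uaff j).
Qed.

Theorem corollary3p3
  (k kbar : fieldType) (iota : {rmorphism k -> kbar})
  (kbar_sep : is_separable_closure iota)
  (Y : schemeOver k) (Y_var : variety Y) (Y_int : integral_scheme Y)
  (Ybar : schemeOver kbar) (pr : morphism Ybar Y)
  (Ybar_bc : is_base_change iota pr)
  (Ybar_units : forall u : sec (opensT Ybar),
      (exists v, u * v = 1) <-> (exists c : kbar, c != 0 /\ u = so_str Ybar c))
  (M : picSubgroup Y) (M_fg : finitely_generated M) (R : coxRing M)
  (m : nat) (g : 'I_m -> R)
  (g_hom : forall j, homogeneous (g j)) (g_neq0 : forall j, g j != 0)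
  (g_cov : refines_affine_covering g)
  (s : nat) (f : 'I_s -> R)
  (f_hom : forall j, homogeneous (f j)) (f_neq0 : forall j, f j != 0)
  (X : scheme) (i : morphism X Y) (i_closed : closed_immersion i)
  (X_ci : complete_intersection i (fun j => div_ideal (f j))) :
  strict_complete_intersection i f <->
  saturated (ideal_gen (range f)) (ideal_gen (range g)).
Proof.
rewrite /strict_complete_intersection /saturated.
(* Once the saturation is replaced by [psi], both sides assert the same equality of ideals. *)
rewrite -(psi_saturation Y_int (variety_qcompact Y_var) g_hom g_neq0 g_cov
  f_hom f_neq0 X_ci.2).
by split=> [[]|].
Qed.
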